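(* Let $X$ be a locally compact Hausdorff space. For a quasi-integral $\zeta$ on $X$ define $\tau_\zeta:\mathcal A(X)\to[0,\infty)$ by $$\tau_\zeta(K)=\inf\{\zeta(f)\mid f\in C_c(X),\ f\ge \mathbf 1_K\},\qquad \tau_\zeta(O)=\sup\{\zeta(f)\mid f\in C_c(X),\ f\le \mathbf 1_O\}$$ for $K\in\mathcal K(X)$, $O\in\mathcal O(X)$. Then $\zeta\mapsto\tau_\zeta$ is a bijection from the set of quasi-integrals on $X$ onto the set of topological measures on $X$.
   Context: $C_c(X)$ denotes real-valued continuous functions with compact support, with the uniform norm $\|f\|=\sup|f|$; $\mathbf 1_A$ is the indicator function of $A$. A quasi-integral on a locally compact Hausdorff space $X$ is a (not necessarily linear) functional $\eta:C_c(X)\to\mathbb R$ such that: (i) (monotonicity) $\eta(f)\le\eta(g)$ whenever $f\le g$; (ii) (Lipschitz continuity) for every compact $K\subset X$ there is $N_K\ge0$ with $|\eta(f)-\eta(g)|\le N_K\|f-g\|$ for all $f,g$ supported in $K$; (iii) (quasi-linearity) for every $f\in C_c(X)$, $\eta$ is linear on the subspace $\{\phi\circ f\mid \phi\in C(\mathbb R),\ \phi(0)=0\}$. Let $\mathcal K(X)$ be the family of compact subsets of $X$, $\mathcal O(X)$ the family of open subsets of $X$ with compact closure, $\mathcal A(X)=\mathcal K(X)\cup\mathcal O(X)$. A topological measure is a function $\tau:\mathcal A(X)\to[0,\infty)$ such that: (additivity) $\tau(A\cup A')=\tau(A)+\tau(A')$ whenever $A,A'\in\mathcal A(X)$ are disjoint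 and $A\cup A'\in\mathcal A(X)$; (monotonicity) $\tau(A)\le\tau(A')$ for $A\subset A'$ in $\mathcal A(X)$; (regularity) $\tau(K)=\inf\{\tau(O)\mid O\in\mathcal O(X),O\supset K\}$ for $K\in\mathcal K(X)$ and $\tau(O)=\sup\{\tau(K)\mid K\in\mathcal K(X),K\subset O\}$ for $O\in\mathcal O(X)$. *)

(* Defs.v *)
From Stdlib Require Import Reals Rtopology List.
Open Scope R_scope.

Section Topo.
Variable X : Type.
Variable op : (X -> Prop) -> Prop.

Definition is_topology : Prop :=
  op (fun _ => True) /\
  (forall U V, op U -> op V -> op (fun x => U x /\ V x)) /\
  (forall F : (X -> Prop) -> Prop, (forall U, F U -> op U) ->
       op (fun x => exists U, F U /\ U x)).

Definition hausdorff : Prop :=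
  forall x y : X, x <> y -> exists U V, op U /\ op V /\ U x /\ V y /\
      (forall z, ~ (U z /\ V z)).

Definition closure (A : X -> Prop) : X -> Prop :=
  fun x => forall U, op U -> U x -> exists y, U y /\ A y.

Definition compact (K : X -> Prop) : Prop :=
  forall F : (X -> Prop) -> Prop, (forall U, F U -> op U) ->
    (forall x, K x -> exists U, F U /\ U x) ->
    exists l : list (X -> Prop), (forall U, In U l -> F U) /\
      (forall x, K x -> exists U, In U l /\ U x).

Definition locally_compact : Prop :=
  forall x : X, exists U, op U /\ U x /\ compact (closure U).

Definition in_K (A : X -> Prop) : Prop := compact A.
Definition in_O (A : X -> Prop) : Prop := op A /\ compact (closure A).
Definition in_A (A : X -> Prop) : Prop := in_K A \/ in_O A.

Definition continuous (f : X -> R) : Prop :=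
  forall V : R -> Prop, open_set V -> op (fun x => V (f x)).

Definition support (f : X -> R) : X -> Prop := closure (fun x => f x <> 0).

Definition Cc (f : X -> R) : Prop := continuous f /\ compact (support f).

Definition supported_in (f : X -> R) (K : X -> Prop) : Prop :=
  forall x, support f x -> K x.

(* Quasi-integrals.  A functional on C_c(X) is represented by a function
   (X -> R) -> R, of which only the values on C_c(X) matter. *)
Definition quasi_integral (eta : (X -> R) -> R) : Prop :=
  (forall f g, Cc f -> Cc g -> (forall x, f x <= g x) -> eta f <= eta g) /\
  (* (ii) Lipschitz continuity; "||f - g|| <= c" is written out pointwise *)
  (forall K, compact K -> exists N, 0 <= N /\
     forall f g, Cc f -> Cc g -> supported_in f K -> supported_in g K ->
       forall c, (forall x, Rabs (f x - g x) <= c) ->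
         Rabs (eta f - eta g) <= N * c) /\
  (forall f, Cc f -> forall (phi psi : R -> R) (a b : R),
     continuity phi -> phi 0 = 0 -> continuity psi -> psi 0 = 0 ->
     eta (fun x => a * phi (f x) + b * psi (f x)) =
       a * eta (fun x => phi (f x)) + b * eta (fun x => psi (f x))).

Definition is_lower_bound (E : R -> Prop) (m : R) : Prop :=
  forall y, E y -> m <= y.
Definition is_glb (E : R -> Prop) (m : R) : Prop :=
  is_lower_bound E m /\ (forall b, is_lower_bound E b -> b <= m).

(* Topological measures: tau : A(X) -> [0, oo), represented as a function on
   all predicates of which only the values on A(X) matter. *)
Definition topological_measure (tau : (X -> Prop) -> R) : Prop :=
  (forall A, in_A A -> 0 <= tau A) /\
  (forall A A', in_A A -> in_A A' -> (forall x, ~ (A x /\ A' x)) ->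
     in_A (fun x => A x \/ A' x) ->
     tau (fun x => A x \/ A' x) = tau A + tau A') /\
  (forall A A', in_A A -> in_A A' -> (forall x, A x -> A' x) ->
     tau A <= tau A') /\
  (forall K, in_K K ->
     is_glb (fun r => exists O, in_O O /\ (forall x, K x -> O x) /\ r = tau O)
            (tau K)) /\
  (forall O, in_O O ->
     is_lub (fun r => exists K, in_K K /\ (forall x, K x -> O x) /\ r = tau K)
            (tau O)).

Definition ge_indicator (f : X -> R) (A : X -> Prop) : Prop :=
  forall x, (A x -> 1 <= f x) /\ (~ A x -> 0 <= f x).
Definition le_indicator (f : X -> R) (A : X -> Prop) : Prop :=
  forall x, (A x -> f x <= 1) /\ (~ A x -> f x <= 0).

Definition is_tau_of (zeta : (X -> R) -> R) (tau : (X -> Prop) -> R) : Prop :=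
  (forall K, in_K K ->
     is_glb (fun r => exists f, Cc f /\ ge_indicator f K /\ r = zeta f) (tau K)) /\
  (forall O, in_O O ->
     is_lub (fun r => exists f, Cc f /\ le_indicator f O /\ r = zeta f) (tau O)).

End Topo.

(* Main.v *)
(** The inverse of [zeta |-> tau] is the Choquet integral
    [f |-> int_0^oo tau (f >= t) dt - int_0^oo tau (- f >= t) dt].
    Its quasi-linearity reduces to one additivity property: if [h] is constant on the set where
    [k] does not vanish, then the integral of [h + k] is the sum of the integrals.  Level by level
    this is additivity of [tau] on disjoint compact sets (where [k] raises [h]) or on a compact
    set and an open set with compact union (where [k] lowers [h]).  Adding the steps of a
    piecewise linear [phi] one at a time then computes the integral of [phi o f] linearly in
    [phi], and the Lipschitz property extends this to continuous [phi].

    In the other direction, quasi-linearity makes [zeta] additive on functions with disjoint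
    positivity sets and on pairs [g = 1 >= f] over the support of [f], which gives additivity of
    [tau]; and cutting [f >= 0] into slices of height [d] determines [zeta f] from [tau] up to
    [d * tau (support f)]. *)

From Stdlib Require Import Reals Rtopology List Lra Lia Classical.
From Stdlib Require Import ClassicalEpsilon FunctionalExtensionality PropExtensionality.
From Coquelicot Require Import Coquelicot.
Require Import Defs.
Open Scope R_scope.

(** A topological measure need not be subadditive and is defined only on compact sets and on
    relatively compact open sets. No limit theorem of measure theory is therefore at hand, and every
    use of additivity has to exhibit a disjoint splitting whose pieces and union all stay in [in_A].
    This dictates the mixture of closed levels [t <= g] and open levels [t < g].

    The Choquet formula is forced by the slices: divided by its height, a slice of [f >= 0] lies
    between the indicators of two consecutive superlevel sets, so [zeta f] lies between lower and
    upper sums of [t |-> tau (f >= t)]. That function is decreasing, hence Riemann integrable.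
    Superlevel sets are compact only for [t > 0], which is why positive and negative parts are
    integrated separately.

    The plateau condition replaces linearity: where [k] does not vanish [h] has a single height, so
    each level set of [h + k] splits disjointly into one set coming from [h] and one from [k].

    Sets are predicates and [tau] acts on them, so two descriptions of one set must be equal for
    [tau] to agree on them; hence the use of extensionality. *)

Lemma set_ext (T : Type) (A B : T -> Prop) : (forall x, A x <-> B x) -> A = B.
Proof.
  intro H; apply functional_extensionality; intro x.
  apply propositional_extensionality, H.
Qed.

(** * Riemann integrability of monotone functions *)

Definition ind (P : Prop) : R := if excluded_middle_informative P then 1 else 0.

Lemma ind_true (P : Prop) : P -> ind P = 1.
Proof. unfold ind; destruct excluded_middle_informative; tauto. Qed.

Lemma ind_false (P : Prop) : ~ P -> ind P = 0.
Proof. unfold ind; destruct excluded_middle_informative; tauto. Qed.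

(** With [c] the supremum of [A] inside the interval, the indicator is 1 on [(a, c)] and 0 on
    [(c, b)]; what happens at [c] itself is irrelevant to the integral. *)
Lemma ex_RInt_initial_segment (A : R -> Prop) a b :
  a <= b -> (forall s t, a < s <= t -> t < b -> A t -> A s) ->
  ex_RInt (fun t => ind (A t)) a b.
Proof.
  intros Hab HA.
  (* The point [a] is adjoined to make the set nonempty; the supremum is [a] when [A] misses the
     interval. *)
  destruct (completeness (fun t => t = a \/ a < t < b /\ A t)) as [c [Hc1 Hc2]].
  - exists b; intros t [-> | [H _]]; lra.
  - exists a; auto.
  - assert (Hac : a <= c) by (apply Hc1; auto).
    assert (Hcb : c <= b) by (apply Hc2; intros t [-> | [H _]]; lra).
    apply ex_RInt_Chasles with c.
    + apply ex_RInt_ext with (fun _ => 1); [|apply ex_RInt_const].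
      intros s; rewrite Rmin_left, Rmax_right by lra; intro Hs; symmetry; apply ind_true.
      apply NNPP; intro HAs.
      assert (c <= s); [|lra].
      apply Hc2; intros t [-> | [H1 H2]]; [lra|].
      apply Rnot_lt_le; intro Hst; apply HAs, (HA s t); auto; lra.
    + apply ex_RInt_ext with (fun _ => 0); [|apply ex_RInt_const].
      intros s; rewrite Rmin_left, Rmax_right by lra; intro Hs; symmetry; apply ind_false.
      intro HAs. assert (s <= c); [|lra]. apply Hc1; right; split; auto; lra.
Qed.

(** Rounds [y >= 0] down to a multiple of [e], capped at [(m + 1) e]. As a sum of indicators of
    conditions [c <= y] it becomes, for [y = F t] with [F] decreasing, a sum of indicators of
    initial segments in [t]. *)
Definition staircase (e : R) (m : nat) (y : R) : R :=
  sum_f_R0 (fun k => e * ind (INR (S k) * e <= y)) m.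

Lemma staircase_spec e y : 0 < e -> 0 <= y -> forall m,
  (INR (S m) * e <= y -> staircase e m y = INR (S m) * e) /\
  (y < INR (S m) * e -> staircase e m y <= y < staircase e m y + e).
Proof.
  intros He Hy; unfold staircase; induction m as [|m [IH1 IH2]].
  - simpl sum_f_R0; simpl INR; split; intro H.
    + rewrite ind_true by lra; lra.
    + rewrite ind_false by (apply Rlt_not_le; lra); lra.
  - rewrite tech5, S_INR; split; intro H.
    + rewrite ind_true by lra. rewrite IH1; lra.
    + rewrite ind_false by (apply Rlt_not_le; lra).
      destruct (Rle_lt_dec (INR (S m) * e) y) as [H' | H'].
      * rewrite IH1; lra.
      * specialize (IH2 H'); lra.
Qed.

Lemma staircase_approx e y m :
  0 < e -> 0 <= y <= INR (S m) * e -> Rabs (staircase e m y - y) <= e.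
Proof.
  intros He [Hy0 Hy]; destruct (staircase_spec e y He Hy0 m) as [H1 H2].
  apply Rabs_le; destruct Hy as [Hy | Hy].
  - specialize (H2 Hy); lra.
  - rewrite H1; lra.
Qed.

(** Rounding the values of [F] instead of subdividing its domain gives integrable functions that
    converge uniformly, and integrability passes to uniform limits. *)
Lemma ex_RInt_decreasing (F : R -> R) a b C :
  a <= b -> (forall t, a < t < b -> 0 <= F t <= C) ->
  (forall s t, a < s <= t -> t < b -> F t <= F s) ->
  ex_RInt F a b.
Proof.
  intros Hab HF Hdec.
  (* The maximum with 1 keeps the step heights [e m] positive. *)
  set (C' := Rmax C 1).
  assert (HC : 0 < C' /\ C <= C') by (unfold C', Rmax; destruct Rle_dec; lra).
  (* Extension by 0, because [filterlim_RInt] asks for uniform convergence on the whole line. *)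
  set (G := fun t => ind (a < t < b) * F t).
  assert (HG : forall t, 0 <= G t <= C').
  { intro t; unfold G, ind; destruct excluded_middle_informative as [H | H]; [|lra].
    specialize (HF t H); lra. }
  assert (HGF : forall t, a < t < b -> G t = F t)
    by (intros t Ht; unfold G; rewrite ind_true; lra).
  apply ex_RInt_ext with G;
    [intros t; rewrite Rmin_left, Rmax_right by lra; apply HGF|].
  set (e := fun m => C' / INR (S m)).
  assert (HSm : forall m, 0 < INR (S m)) by (intro m; apply lt_0_INR; lia).
  assert (He : forall m, 0 < e m) by (intro m; apply Rdiv_lt_0_compat; [lra | apply HSm]).
  assert (Hint : forall m, ex_RInt (fun t => staircase (e m) m (G t)) a b).
  { intro m; unfold staircase.
    assert (Hk : forall k, ex_RInt (fun t => e m * ind (INR (S k) * e m <= G t)) a b).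
    { intro k. apply (ex_RInt_scal (V := R_NormedModule)).
      apply ex_RInt_initial_segment; auto.
      intros s t Hst Ht H. rewrite HGF in * by lra. specialize (Hdec s t Hst Ht); lra. }
    (* The number of terms is separated from the step [e m], which stays fixed during the
       induction. *)
    generalize m at 3; induction m0 as [|q IH]; [apply Hk|].
    apply (ex_RInt_plus (V := R_NormedModule)); auto. }
  destruct (filterlim_RInt (V := R_CompleteNormedModule)
              (fun m t => staircase (e m) m (G t)) a b eventually eventually_filter G
              (fun m => RInt (fun t => staircase (e m) m (G t)) a b)) as [I [_ HI]].
  - intro m; apply RInt_correct, Hint.
  - apply filterlim_locally; intros eps.
    destruct (nfloor_ex (C' / eps)) as [N HN];
      [apply Rlt_le, Rdiv_lt_0_compat; [lra | apply cond_pos]|].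
    exists N; intros m Hm t.
    change (Rabs (staircase (e m) m (G t) - G t) < eps).
    apply Rle_lt_trans with (e m).
    + apply staircase_approx; auto.
      replace (INR (S m) * e m) with C'; auto.
      unfold e; field. apply Rgt_not_eq, HSm.
    + unfold e; apply Rlt_div_l; [apply HSm|].
      assert (INR (S N) <= INR (S m)) by (apply le_INR; lia).
      rewrite (S_INR N) in H. assert (Hp := cond_pos eps).
      destruct HN as [_ HN]; apply Rlt_div_l in HN; [|exact Hp]. nra.
  - exists I; exact HI.
Qed.

(** * Splitting and changing variables in Riemann integrals *)

Lemma is_RInt_split (F : R -> R) a b c I :
  a <= b <= c -> is_RInt F a c I ->
  exists I1 I2, is_RInt F a b I1 /\ is_RInt F b c I2 /\ I = I1 + I2.
Proof.
  intros Habc HI.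
  assert (Hex : ex_RInt F a c) by (exists I; auto).
  destruct (ex_RInt_Chasles_1 _ _ _ _ Habc Hex) as [I1 H1].
  destruct (ex_RInt_Chasles_2 _ _ _ _ Habc Hex) as [I2 H2].
  exists I1, I2; split; [|split]; auto.
  rewrite <- (is_RInt_unique _ _ _ _ HI).
  apply is_RInt_unique, (is_RInt_Chasles _ _ _ _ _ _ H1 H2).
Qed.

Lemma is_RInt_ext_le (F G : R -> R) a b I :
  a <= b -> (forall t, a < t < b -> F t = G t) -> is_RInt F a b I -> is_RInt G a b I.
Proof.
  intros Hab H; apply is_RInt_ext; intro t; rewrite Rmin_left, Rmax_right by lra; auto.
Qed.

Lemma is_RInt_const_R a b v : is_RInt (fun _ => v) a b ((b - a) * v).
Proof. apply (is_RInt_const (V := R_NormedModule)). Qed.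

Lemma is_RInt_inj (F : R -> R) a b I J : is_RInt F a b I -> is_RInt F a b J -> I = J.
Proof.
  intros HI HJ; rewrite <- (is_RInt_unique _ _ _ _ HI); apply is_RInt_unique, HJ.
Qed.

Lemma is_RInt_shift (F : R -> R) a b c I :
  is_RInt F a b I -> is_RInt (fun t => F (t - c)) (a + c) (b + c) I.
Proof.
  intro HI.
  apply is_RInt_ext with (fun t => scal 1 (F (1 * t + - c))).
  - intros t _. change (1 * F (1 * t + - c) = F (t - c)).
    replace (1 * t + - c) with (t - c) by lra; lra.
  - apply (is_RInt_comp_lin (V := R_NormedModule)).
    replace (1 * (a + c) + - c) with a by lra.
    replace (1 * (b + c) + - c) with b by lra. exact HI.
Qed.

Lemma is_RInt_reflect (F : R -> R) b I :
  is_RInt F 0 b I -> is_RInt (fun t => F (b - t)) 0 b I.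
Proof.
  intro HI.
  apply is_RInt_ext with (fun t => opp (scal (-1) (F (-1 * t + b)))).
  - intros t _. change (- (-1 * F (-1 * t + b)) = F (b - t)).
    replace (-1 * t + b) with (b - t) by lra; lra.
  - replace I with (- - I) by lra.
    apply (is_RInt_opp (V := R_NormedModule)), (is_RInt_comp_lin (V := R_NormedModule)).
    replace (-1 * 0 + b) with b by lra. replace (-1 * b + b) with 0 by lra.
    apply (is_RInt_swap (V := R_NormedModule)); exact HI.
Qed.

Lemma is_RInt_dilate (F : R -> R) b c I :
  0 < c -> is_RInt F 0 b I -> is_RInt (fun t => F (t / c)) 0 (c * b) (c * I).
Proof.
  intros Hc HI.
  apply is_RInt_ext with (fun t => scal c (scal (/ c) (F (/ c * t + 0)))).
  - intros t _. change (c * (/ c * F (/ c * t + 0)) = F (t / c)).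
    replace (/ c * t + 0) with (t / c) by (unfold Rdiv; lra). field; lra.
  - apply (is_RInt_scal (V := R_NormedModule)), (is_RInt_comp_lin (V := R_NormedModule)).
    replace (/ c * 0 + 0) with 0 by lra. replace (/ c * (c * b) + 0) with b by (field; lra).
    exact HI.
Qed.

Lemma lipschitz_continuity (phi : R -> R) (L : R) :
  (forall s t, Rabs (phi s - phi t) <= L * Rabs (s - t)) -> continuity phi.
Proof.
  intros H s eps Heps. exists (eps / (Rabs L + 1)).
  pose proof (Rabs_pos L); pose proof (Rle_abs L).
  split; [apply Rdiv_lt_0_compat; lra|].
  intros t [_ Ht]; simpl in *; unfold Rdist in *.
  apply Rle_lt_trans with (1 := H t s).
  apply Rlt_div_r in Ht; [|lra].
  pose proof (Rabs_pos (t - s)); nra.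
Qed.

Local Ltac lipschitz_one := apply (lipschitz_continuity _ 1); intros ? ?;
  unfold Rmax, Rmin, Rabs; repeat destruct Rle_dec; repeat destruct Rcase_abs; lra.

(** * Locally compact Hausdorff spaces *)

Section LocallyCompactHausdorff.
Variable X : Type.
Variable op : (X -> Prop) -> Prop.
Hypothesis Htop : is_topology X op.
Hypothesis Hhaus : hausdorff X op.
Hypothesis Hlc : locally_compact X op.

Local Notation set := (X -> Prop).
Local Notation closure := (Defs.closure X op).
Local Notation compact := (Defs.compact X op).
Local Notation Cc := (Defs.Cc X op).
Local Notation support := (Defs.support X op).

Definition closed (C : set) : Prop := op (fun x => ~ C x).

Lemma open_full : op (fun _ => True).
Proof. exact (proj1 Htop). Qed.

Lemma open_inter (U V : set) : op U -> op V -> op (fun x => U x /\ V x).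
Proof. apply (proj1 (proj2 Htop)). Qed.

(** Such a set is the union of the open sets contained in it; the union axiom is used only in this
    form. *)
Lemma open_local (A : set) :
  (forall x, A x -> exists U, op U /\ U x /\ forall y, U y -> A y) -> op A.
Proof.
  intro H.
  replace A with (fun x => exists U, (op U /\ forall y, U y -> A y) /\ U x).
  - apply (proj2 (proj2 Htop)). tauto.
  - apply set_ext; intro x; split.
    + intros [U [[_ HU] Hx]]; auto.
    + intro Hx; destruct (H x Hx) as [U [H1 [H2 H3]]]; eauto.
Qed.

Lemma open_union (U V : set) : op U -> op V -> op (fun x => U x \/ V x).
Proof.
  intros HU HV; apply open_local; intros x [H | H];
    [exists U | exists V]; auto.
Qed.

Lemma open_empty : op (fun _ => False).
Proof. apply open_local; tauto. Qed.

Lemma open_diff (U C : set) : op U -> closed C -> op (fun x => U x /\ ~ C x).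
Proof. apply open_inter. Qed.

Lemma closed_closure (A : set) : closed (closure A).
Proof.
  apply open_local; intros x Hx.
  apply not_all_ex_not in Hx; destruct Hx as [U HU].
  apply imply_to_and in HU; destruct HU as [HU H].
  apply imply_to_and in H; destruct H as [Ux H].
  exists U; repeat split; auto.
Qed.

Lemma subset_closure (A : set) x : A x -> closure A x.
Proof. intros Ax U _ Ux; eauto. Qed.

Lemma closure_min (A C : set) :
  closed C -> (forall x, A x -> C x) -> forall x, closure A x -> C x.
Proof.
  intros HC H x Hx; apply NNPP; intro Cx.
  destruct (Hx _ HC Cx) as [y [Hy1 Hy2]]; auto.
Qed.

Lemma closure_mono (A B : set) :
  (forall x, A x -> B x) -> forall x, closure A x -> closure B x.
Proof.
  intros H; apply closure_min; [apply closed_closure|].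
  intros; apply subset_closure; auto.
Qed.

(** Compactness as an induction principle: the open sets satisfying [Q] cover [K], and a finite
    subcover is assembled by the union rule. It spares later proofs the handling of lists. *)
Lemma compact_ind (K : set) (Q : set -> Prop) :
  compact K ->
  Q (fun _ => False) ->
  (forall A B, Q A -> Q B -> Q (fun x => A x \/ B x)) ->
  (forall A B : set, (forall x, A x -> B x) -> Q B -> Q A) ->
  (forall x, K x -> exists U, op U /\ U x /\ Q U) ->
  Q K.
Proof.
  intros HK Q0 QU Qmono Hloc.
  destruct (HK (fun U => op U /\ Q U)) as [l [Hl HKl]]; [tauto| |].
  - intros x Kx; destruct (Hloc x Kx) as [U [H1 [H2 H3]]]; eauto.
  - apply Qmono with (B := fun x => exists U, In U l /\ U x); [exact HKl|].
    clear HKl; induction l as [|U l IH].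
    + apply Qmono with (2 := Q0); intros x [U [[] _]].
    + apply Qmono with (B := fun x => U x \/ exists V, In V l /\ V x).
      * intros x [V [[<- | HV] Vx]]; eauto.
      * apply QU; [apply Hl; left; auto|]. apply IH; intros V HV; apply Hl; right; auto.
Qed.

Lemma compact_subset (K C : set) :
  compact K -> closed C -> (forall x, C x -> K x) -> compact C.
Proof.
  intros HK HC HCK F HF Hcov.
  assert (H : exists l, (forall U, In U l -> F U) /\
                forall x, K x -> C x -> exists U, In U l /\ U x);
    [|destruct H as [l [H1 H2]]; exists l; split; auto].
  apply (compact_ind K (fun A => exists l, (forall U, In U l -> F U) /\
           forall x, A x -> C x -> exists U, In U l /\ U x) HK).
  - exists nil; simpl; tauto.
  - intros A B [l [H1 H2]] [m [H3 H4]]; exists (l ++ m); split.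
    + intros U HU; apply in_app_or in HU; destruct HU; auto.
    + intros x [Ax | Bx] Cx.
      * destruct (H2 x Ax Cx) as [U [HU Ux]]; exists U; split; auto.
        apply in_or_app; auto.
      * destruct (H4 x Bx Cx) as [U [HU Ux]]; exists U; split; auto.
        apply in_or_app; auto.
  - intros A B HAB [l [H1 H2]]; exists l; split; auto.
  - intros x Kx; destruct (classic (C x)) as [Cx | Cx].
    + destruct (Hcov x Cx) as [U [FU Ux]]; exists U; repeat split; auto.
      exists (U :: nil); split.
      * intros V [<- | []]; auto.
      * intros y Uy _; exists U; simpl; auto.
    + exists (fun y => ~ C y); repeat split; auto.
      exists nil; split; simpl; tauto.
Qed.

Lemma compact_empty : compact (fun _ => False).
Proof. intros F _ _; exists nil; simpl; split; tauto. Qed.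

Lemma compact_union (K L : set) :
  compact K -> compact L -> compact (fun x => K x \/ L x).
Proof.
  intros HK HL F HF Hcov.
  destruct (HK F HF) as [l [H1 H2]]; [auto|].
  destruct (HL F HF) as [m [H3 H4]]; [auto|].
  exists (l ++ m); split.
  - intros U HU; apply in_app_or in HU; destruct HU; auto.
  - intros x [Kx | Lx].
    + destruct (H2 x Kx) as [U [HU Ux]]; exists U; split; auto; apply in_or_app; auto.
    + destruct (H4 x Lx) as [U [HU Ux]]; exists U; split; auto; apply in_or_app; auto.
Qed.

(** * Separation and interpolation of sets *)

Lemma separate_point (K : set) x :
  compact K -> ~ K x ->
  exists N M, op N /\ op M /\ N x /\ (forall y, K y -> M y) /\
    forall y, ~ (N y /\ M y).
Proof.
  intros HK Kx.
  assert (H : exists N M, op N /\ op M /\ N x /\ (forall y, K y -> y <> x -> M y) /\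
    forall y, ~ (N y /\ M y)).
  - apply (compact_ind K (fun A => exists N M, op N /\ op M /\ N x /\
             (forall y, A y -> y <> x -> M y) /\ forall y, ~ (N y /\ M y)) HK).
    + exists (fun _ => True), (fun _ => False); repeat split; auto using open_full, open_empty.
      tauto.
    + intros A B [N [M [H1 [H2 [H3 [H4 H5]]]]]] [N' [M' [H1' [H2' [H3' [H4' H5']]]]]].
      exists (fun y => N y /\ N' y), (fun y => M y \/ M' y).
      repeat split; auto using open_inter, open_union.
      * intros y [Ay | By]; auto.
      * intros y [[? ?] [? | ?]]; [apply (H5 y) | apply (H5' y)]; auto.
    + intros A B HAB [N [M [H1 [H2 [H3 [H4 H5]]]]]]; exists N, M; repeat split; auto.
    + intros y Ky.
      assert (Hne : x <> y) by congruence.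
      destruct (Hhaus x y Hne) as [N [M [H1 [H2 [H3 [H4 H5]]]]]].
      exists M; repeat split; auto. exists N, M; repeat split; auto.
  - destruct H as [N [M [H1 [H2 [H3 [H4 H5]]]]]]; exists N, M; repeat split; auto.
    intros y Ky; apply H4; congruence.
Qed.

Lemma compact_closed (K : set) : compact K -> closed K.
Proof.
  intro HK; apply open_local; intros x Kx.
  destruct (separate_point K x HK Kx) as [N [M [H1 [H2 [H3 [H4 H5]]]]]].
  exists N; repeat split; auto. intros y Ny Ky; apply (H5 y); auto.
Qed.

Lemma compact_closure_sub (A K : set) :
  compact K -> (forall x, A x -> K x) -> compact (closure A).
Proof.
  intros HK H; apply (compact_subset K); auto using closed_closure.
  apply closure_min; auto using compact_closed.
Qed.

(** The statement is stable under finite unions in [K], so it only has to be proved near a point,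
    where a relatively compact neighbourhood is shrunk until its closure lies in [U]. *)
Lemma interpolate (K U : set) :
  compact K -> op U -> (forall x, K x -> U x) ->
  exists V, op V /\ (forall x, K x -> V x) /\ compact (closure V) /\
    (forall x, closure V x -> U x).
Proof.
  intros HK HU HKU.
  apply (compact_ind K (fun A => exists V, op V /\ (forall x, A x -> V x) /\
           compact (closure V) /\ (forall x, closure V x -> U x)) HK).
  - exists (fun _ => False); split; [apply open_empty|]; split; [tauto|].
    assert (H : forall x, closure (fun _ => False) x -> False)
      by (intros x Hx; destruct (Hx _ open_full I); tauto).
    split; [|firstorder].
    apply (compact_closure_sub _ _ compact_empty); auto.
  - intros A B [V [H1 [H2 [H3 H4]]]] [W [H1' [H2' [H3' H4']]]].
    exists (fun x => V x \/ W x).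
    assert (H : forall x, closure (fun x => V x \/ W x) x -> closure V x \/ closure W x).
    { apply closure_min.
      - apply compact_closed, compact_union; auto.
      - intros x [? | ?]; [left | right]; apply subset_closure; auto. }
    split; [auto using open_union|]. split; [firstorder|]. split.
    + apply (compact_closure_sub _ (fun x => closure V x \/ closure W x)).
      * apply compact_union; auto.
      * intros x [? | ?]; [left | right]; apply subset_closure; auto.
    + intros x Hx; destruct (H x Hx); auto.
  - intros A B HAB [V [H1 [H2 H3]]]; exists V; split; auto.
  - intros x Kx.
    destruct (Hlc x) as [P [HP [Px HcP]]].
    (* The part of [closure P] outside [U] is compact and lies in [M]; since [N] is disjoint from
       the open set [M], the closure of [P] intersected with [N] avoids that part. *)
    destruct (separate_point (fun y => closure P y /\ ~ U y) x)
      as [N [M [H1 [H2 [H3 [H4 H5]]]]]].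
    + apply (compact_subset (closure P)); [auto | | tauto].
      replace (closed (fun y => closure P y /\ ~ U y))
        with (op (fun y => ~ closure P y \/ U y)).
      * apply open_union; auto using closed_closure. apply closed_closure.
      * unfold closed; f_equal; apply set_ext; intro y; tauto.
    + intros [_ Ux]; auto.
    + exists (fun y => P y /\ N y); repeat split; auto using open_inter.
      exists (fun y => P y /\ N y).
      split; [auto using open_inter|]. split; [auto|]. split.
      * apply (compact_closure_sub _ (closure P)); auto.
        intros y [Py _]; apply subset_closure; auto.
      * intros y Hy; apply NNPP; intro Uy.
        assert (Hy' : closure P y) by (revert Hy; apply closure_mono; tauto).
        destruct (Hy M H2 (H4 y (conj Hy' Uy))) as [z [Mz [_ Nz]]].
        apply (H5 z); auto.
Qed.

Lemma continuous_pointwise (f : X -> R) :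
  Defs.continuous X op f <->
  forall x eps, 0 < eps -> exists U, op U /\ U x /\ forall y, U y -> Rabs (f y - f x) < eps.
Proof.
  split.
  - intros Hf x eps Heps.
    exists (fun y => disc (f x) (mkposreal eps Heps) (f y)); repeat split.
    + apply Hf, disc_P1.
    + unfold disc; simpl. rewrite Rminus_diag, Rabs_R0; auto.
    + auto.
  - intros Hf V HV; apply open_local; intros x Vx.
    destruct (HV _ Vx) as [d Hd].
    destruct (Hf x d (cond_pos d)) as [U [H1 [H2 H3]]].
    exists U; repeat split; auto. intros y Uy; apply Hd, H3; auto.
Qed.

(** * Urysohn's lemma *)

Definition well_inside (A B : set) : Prop :=
  op A /\ op B /\ compact (closure A) /\ forall x, closure A x -> B x.

Lemma well_inside_subset A B : well_inside A B -> forall x, A x -> B x.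
Proof. intros [_ [_ [_ H]]] x Ax; apply H, subset_closure, Ax. Qed.

(** Choice turns interpolation into a total function of the two sets, so that the dyadic chain can
    be defined by plain recursion; pairs that are not nested get the dummy value [A]. *)
Lemma well_inside_between :
  exists I : set -> set -> set, forall A B, well_inside A B ->
    well_inside A (I A B) /\ well_inside (I A B) B.
Proof.
  assert (H : forall p : set * set, exists C, well_inside (fst p) (snd p) ->
            well_inside (fst p) C /\ well_inside C (snd p)).
  - intros [A B]; simpl.
    destruct (classic (well_inside A B)) as [H | H]; [|exists A; tauto].
    destruct H as [HA [HB [HcA HAB]]].
    destruct (interpolate _ _ HcA HB HAB) as [C [HC [H1 [H2 H3]]]].
    exists C; intros _; repeat split; auto.
  - apply choice in H; destruct H as [I HI].
    exists (fun A B => I (A, B)); intros A B; apply (HI (A, B)).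
Qed.

Section DyadicChain.
Variable I : set -> set -> set.
Hypothesis HI : forall A B, well_inside A B -> well_inside A (I A B) /\ well_inside (I A B) B.
Variables A B : set.
Hypothesis HAB : well_inside A B.

(* [chain n k], for [k <= 2 ^ n], is the set attached to the dyadic number [k / 2 ^ n]. *)
Fixpoint chain (n : nat) : nat -> set :=
  match n with
  | O => fun k => match k with O => A | _ => B end
  | S n => fun k =>
      if Nat.even k then chain n (Nat.div2 k)
      else I (chain n (Nat.div2 k)) (chain n (S (Nat.div2 k)))
  end.

Lemma chain_S n k :
  chain (S n) k = if Nat.even k then chain n (Nat.div2 k)
                  else I (chain n (Nat.div2 k)) (chain n (S (Nat.div2 k))).
Proof. reflexivity. Qed.

Lemma chain_even n k : chain (S n) (2 * k) = chain n k.
Proof.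
  now rewrite chain_S, Nat.even_even, Nat.div2_double.
Qed.

Lemma chain_odd n k : chain (S n) (2 * k + 1) = I (chain n k) (chain n (S k)).
Proof.
  rewrite chain_S, Nat.even_odd, Nat.add_1_r; now rewrite Nat.div2_succ_double.
Qed.

Lemma chain_succ n : forall k, (k < 2 ^ n)%nat -> well_inside (chain n k) (chain n (S k)).
Proof.
  induction n as [|n IH]; intros k Hk.
  - simpl in Hk. replace k with 0%nat by lia. exact HAB.
  - rewrite Nat.pow_succ_r' in Hk.
    destruct (Nat.Even_or_Odd k) as [[j ->] | [j ->]].
    + replace (S (2 * j)) with (2 * j + 1)%nat by lia.
      rewrite chain_even, chain_odd; apply HI, IH; lia.
    + replace (S (2 * j + 1)) with (2 * S j)%nat by lia.
      rewrite chain_even, chain_odd; apply HI, IH; lia.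
Qed.

Lemma chain_subset n j k x : (j <= k <= 2 ^ n)%nat -> chain n j x -> chain n k x.
Proof.
  intros [Hjk Hk]; induction Hjk as [|k Hjk IH]; auto.
  intro Hx; apply (well_inside_subset (chain n k)); [apply chain_succ; lia|].
  apply IH; auto; lia.
Qed.

Lemma chain_refine n p : forall k, chain (n + p) (k * 2 ^ p) = chain n k.
Proof.
  induction p as [|p IH]; intro k.
  - rewrite Nat.add_0_r; f_equal; simpl; lia.
  - rewrite <- (IH k), <- (chain_even (n + p)). rewrite Nat.add_succ_r, Nat.pow_succ_r'.
    f_equal; lia.
Qed.

(** The hypothesis is [j / 2 ^ m <= k / 2 ^ n] with denominators cleared; both sets are rewritten at
    the common level [n + m]. *)
Lemma chain_mono m j n k x :
  (j * 2 ^ n <= k * 2 ^ m)%nat -> (k <= 2 ^ n)%nat -> chain m j x -> chain n k x.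
Proof.
  intros Hjk Hk Hx.
  rewrite <- (chain_refine n m); rewrite <- (chain_refine m n) in Hx.
  rewrite (Nat.add_comm n m). apply (chain_subset _ (j * 2 ^ n)); auto.
  split; auto. rewrite (Nat.add_comm m n), Nat.pow_add_r.
  apply Nat.mul_le_mono_r; auto.
Qed.

Lemma pow2_INR n : INR (2 ^ n) = 2 ^ n.
Proof. rewrite pow_INR; reflexivity. Qed.

(** [g x] is the supremum of [1 - q] over the dyadic [q] whose set contains [x], with 0 adjoined for
    the points outside all of them. *)
Lemma urysohn_function :
  exists g : X -> R,
    (forall x, 0 <= g x <= 1) /\ (forall x, ~ B x -> g x = 0) /\
    forall n k x, (k <= 2 ^ n)%nat ->
      (chain n k x -> 1 - INR k / 2 ^ n <= g x) /\
      (~ chain n k x -> g x <= 1 - INR k / 2 ^ n).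
Proof.
  set (E := fun x r => r = 0 \/
    exists n k, (k <= 2 ^ n)%nat /\ chain n k x /\ r = 1 - INR k / 2 ^ n).
  assert (Hfrac : forall n k, (k <= 2 ^ n)%nat -> 0 <= INR k / 2 ^ n <= 1).
  { intros n k Hk. assert (H2 : 0 < 2 ^ n) by (apply pow_lt; lra).
    split; [apply Rdiv_le_0_compat; auto using pos_INR|].
    apply Rle_div_l; auto. rewrite Rmult_1_l, <- pow2_INR; apply le_INR, Hk. }
  assert (Hlub : forall x, exists r, is_lub (E x) r).
  { intro x. destruct (completeness (E x)) as [r Hr].
    - exists 1; intros r [-> | [n [k [Hk [_ ->]]]]]; [lra|].
      specialize (Hfrac n k Hk); lra.
    - exists 0; left; auto.
    - exists r; auto. }
  apply choice in Hlub; destruct Hlub as [g Hg]. exists g.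
  split; [|split].
  - intro x; destruct (Hg x) as [H1 H2]; split.
    + apply H1; left; auto.
    + apply H2; intros r [-> | [n [k [Hk [_ ->]]]]]; [lra|].
      specialize (Hfrac n k Hk); lra.
  - intros x Bx; destruct (Hg x) as [H1 H2]; apply Rle_antisym.
    + apply H2; intros r [-> | [n [k [Hk [Hx ->]]]]]; [lra|].
      exfalso; apply Bx. apply (chain_mono n k 0 1); simpl; auto; lia.
    + apply H1; left; auto.
  - intros n k x Hk; destruct (Hg x) as [H1 H2]; split; intro Hx.
    + apply H1; right; exists n, k; auto.
    + apply H2; intros r [-> | [m [j [Hj [Hmx ->]]]]].
      * specialize (Hfrac n k Hk); lra.
      * assert (Hlt : (k * 2 ^ m < j * 2 ^ n)%nat).
        { apply Nat.nle_gt; intro H; apply Hx, (chain_mono m j); auto. }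
        assert (Hn : 0 < 2 ^ n) by (apply pow_lt; lra).
        assert (Hm : 0 < 2 ^ m) by (apply pow_lt; lra).
        apply lt_INR in Hlt. rewrite !mult_INR, !pow2_INR in Hlt.
        assert (INR k / 2 ^ n <= INR j / 2 ^ m); [|lra].
        apply Rle_div_l; auto. unfold Rdiv. rewrite Rmult_assoc, (Rmult_comm (/ _)), <- Rmult_assoc.
        apply Rle_div_r; auto. lra.
Qed.

(** Continuity is read off at a single level [n]: each point has a neighbourhood, cut out by at most
    two sets of the chain, on which [g] stays in an interval of length [2 / 2 ^ n]. *)
Lemma urysohn_chain :
  exists g : X -> R, Defs.continuous X op g /\ (forall x, 0 <= g x <= 1) /\
    (forall x, A x -> g x = 1) /\ (forall x, ~ B x -> g x = 0).
Proof.
  destruct urysohn_function as [g [Hg01 [HgB Hg]]].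
  exists g; split; [|split; [|split]]; auto.
  - apply continuous_pointwise; intros x eps Heps.
    destruct (pow_lt_1_zero (/ 2)) with (y := eps / 2) as [n Hn];
      [rewrite Rabs_pos_eq; lra | lra |].
    specialize (Hn n (le_n n)). rewrite Rabs_pos_eq in Hn by (apply pow_le; lra).
    rewrite pow_inv in Hn.
    assert (H2 : 0 < 2 ^ n) by (apply pow_lt; lra).
    assert (H2' : 0 < / 2 ^ n) by (apply Rinv_0_lt_compat, H2).
    set (d := / 2 ^ n) in *.
    assert (Hpos : (2 ^ n <> 0)%nat) by (apply Nat.pow_nonzero; lia).
    assert (Hloc : exists U, op U /\ U x /\
              exists c, forall y, U y -> c <= g y <= c + 2 * d).
    { assert (Hscan : forall k, (k <= 2 ^ n)%nat -> chain n k x ->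
                exists U, op U /\ U x /\ exists c, forall y, U y -> c <= g y <= c + 2 * d).
      { induction k as [|k IH]; intros Hk Hx.
        - exists (chain n 0); split; [|split]; auto.
          + apply (chain_succ n 0); lia.
          + exists 1; intros y Hy. destruct (Hg n 0%nat y) as [H _]; auto.
            specialize (H Hy); simpl in H. specialize (Hg01 y); unfold Rdiv in H; lra.
        - destruct (classic (chain n k x)) as [Hkx | Hkx]; [apply IH; auto; lia|].
          destruct k as [|k].
          + exists (chain n 1); split; [|split]; auto.
            * apply (chain_succ n 0); lia.
            * exists (1 - d); intros y Hy. destruct (Hg n 1%nat y) as [H _]; auto.
              specialize (H Hy); simpl in H. specialize (Hg01 y).
              unfold Rdiv in H; fold d in H; lra.
          (* The point [x] is outside [chain n (k + 1)], hence outside the closure of [chain n k].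
             On this ring [g] lies between [1 - (k + 2) / 2 ^ n] and [1 - k / 2 ^ n]. *)
          + exists (fun y => chain n (S (S k)) y /\ ~ closure (chain n k) y).
            destruct (chain_succ n k) as [_ [_ [_ Hk1]]]; [lia|].
            destruct (chain_succ n (S k)) as [_ [Hk2 _]]; [lia|].
            split; [|split]; auto.
            * apply open_diff; auto. apply closed_closure.
            * exists (1 - INR (S (S k)) / 2 ^ n); intros y [Hy1 Hy2].
              destruct (Hg n (S (S k)) y) as [H _]; auto. split; auto.
              destruct (Hg n k y) as [_ H']; [lia|].
              apply Rle_trans with (1 - INR k / 2 ^ n).
              { apply H'; intro; apply Hy2, subset_closure; auto. }
              rewrite !S_INR; unfold Rdiv; fold d; lra. }
      destruct (classic (chain n (2 ^ n) x)) as [Hx | Hx]; [apply (Hscan (2 ^ n)%nat); auto|].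
      set (k := (2 ^ n - 1)%nat).
      destruct (chain_succ n k) as [_ [_ [_ Hk]]]; [lia|].
      replace (S k) with (2 ^ n)%nat in Hk by lia.
      exists (fun y => ~ closure (chain n k) y); split; [apply closed_closure|].
      split; auto.
      exists 0; intros y Hy; split; [apply Hg01|].
      destruct (Hg n k y) as [_ H]; [lia|].
      apply Rle_trans with (1 - INR k / 2 ^ n).
      { apply H; intro; apply Hy, subset_closure; auto. }
      unfold k; rewrite minus_INR, pow2_INR by lia; simpl INR.
      unfold Rdiv; fold d. rewrite Rmult_minus_distr_r.
      unfold d at 1; rewrite Rinv_r by lra. lra. }
    destruct Hloc as [U [HU [Ux [c Hc]]]]; exists U; split; [|split]; auto.
    intros y Uy. pose proof (Hc y Uy); pose proof (Hc x Ux).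
    apply Rabs_def1; lra.
  - intros x Ax. destruct (Hg 0%nat 0%nat x) as [H _]; [lia|].
    specialize (H Ax); simpl in H. specialize (Hg01 x); lra.
Qed.

End DyadicChain.

Lemma Cc_intro (f : X -> R) (K : set) :
  Defs.continuous X op f -> compact K -> (forall x, f x <> 0 -> K x) -> Cc f.
Proof.
  intros Hf HK H; split; auto. apply (compact_closure_sub _ K); auto.
Qed.

(** Two interpolations are made: the function is 1 on [A], which contains [K], and 0 off [B], whose
    compact closure inside [U] contains the support. *)
Lemma urysohn (K U : set) :
  compact K -> op U -> (forall x, K x -> U x) ->
  exists f, Cc f /\ (forall x, 0 <= f x <= 1) /\ (forall x, K x -> f x = 1) /\
    (forall x, support f x -> U x).
Proof.
  intros HK HU HKU.
  destruct (interpolate K U) as [B [HB [HKB [HcB HBU]]]]; auto.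
  destruct (interpolate K B) as [A [HA [HKA [HcA HAB]]]]; auto.
  destruct well_inside_between as [I HI].
  destruct (urysohn_chain I HI A B) as [f [Hf [H01 [H1 H0]]]];
    [repeat split; auto|].
  assert (Hsupp : forall x, f x <> 0 -> B x)
    by (intros x Hx; apply NNPP; intro; apply Hx; auto).
  exists f; split; [|split; [|split]]; auto.
  - apply (Cc_intro f (closure B)); auto.
    intros x Hx; apply subset_closure; auto.
  - intros x Hx; apply HBU; revert Hx; apply closure_mono; auto.
Qed.

(** * Compactly supported functions *)

Lemma Cc_comp (phi : R -> R) f :
  Cc f -> continuity phi -> phi 0 = 0 -> Cc (fun x => phi (f x)).
Proof.
  intros [Hf HK] Hphi H0. apply (Cc_intro _ (support f)); auto.
  - apply continuous_pointwise; auto; intros x eps Heps.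
    destruct (Hphi (f x) eps Heps) as [d [Hd Hlim]].
    destruct (proj1 (continuous_pointwise f) Hf x d Hd) as [U [HU [Ux HUd]]].
    exists U; split; [|split]; auto. intros y Uy.
    (* The limit in [continuity] is punctured, so the points with [f y = f x] are treated apart. *)
    destruct (Req_dec (f y) (f x)) as [E | E].
    + rewrite E, Rminus_diag, Rabs_R0; auto.
    + apply (Hlim (f y)); split; [split; auto; exact I|]. apply HUd; auto.
  - intros x Hx; apply subset_closure; intro E; apply Hx; rewrite E; auto.
Qed.

(** One estimate serves sum, difference, minimum and maximum alike. *)
Lemma Cc_binary (F : R -> R -> R) f g :
  (forall a b c d, Rabs (F a b - F c d) <= Rabs (a - c) + Rabs (b - d)) -> F 0 0 = 0 ->
  Cc f -> Cc g -> Cc (fun x => F (f x) (g x)).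
Proof.
  intros HF H0 [Hf HKf] [Hg HKg].
  apply (Cc_intro _ (fun x => support f x \/ support g x)); auto using compact_union.
  - apply continuous_pointwise; auto; intros x eps Heps.
    destruct (proj1 (continuous_pointwise f) Hf x (eps / 2)) as [U [HU [Ux HUd]]]; [lra|].
    destruct (proj1 (continuous_pointwise g) Hg x (eps / 2)) as [V [HV [Vx HVd]]]; [lra|].
    exists (fun y => U y /\ V y); split; [|split]; auto using open_inter.
    intros y [Uy Vy]. apply Rle_lt_trans with (1 := HF _ _ _ _).
    specialize (HUd y Uy); specialize (HVd y Vy); lra.
  - intros x Hx. destruct (Req_dec (f x) 0) as [E | E].
    + right; apply subset_closure; intro E'; apply Hx; rewrite E, E'; auto.
    + left; apply subset_closure; auto.
Qed.

Lemma Cc_zero : Cc (fun _ => 0).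
Proof.
  apply (Cc_intro _ (fun _ => False)); auto using compact_empty.
  apply continuous_pointwise; auto; intros x eps Heps.
  exists (fun _ => True); split; [apply open_full|]; split; auto.
  intros; rewrite Rminus_diag, Rabs_R0; auto.
Qed.

Lemma Cc_scal c f : Cc f -> Cc (fun x => c * f x).
Proof.
  intro Hf. apply (Cc_comp (fun s => c * s)); auto; [|lra].
  apply (lipschitz_continuity _ (Rabs c)); intros s t.
  rewrite <- Rabs_mult; right; f_equal; lra.
Qed.

Lemma Cc_opp f : Cc f -> Cc (fun x => - f x).
Proof.
  intro Hf. replace (fun x => - f x) with (fun x => -1 * f x)
    by (apply functional_extensionality; intro; lra).
  apply Cc_scal, Hf.
Qed.

Local Ltac binary := intros a b c d; unfold Rmin, Rmax, Rabs;
  repeat destruct Rle_dec; repeat destruct Rcase_abs; lra.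

Lemma Cc_plus f g : Cc f -> Cc g -> Cc (fun x => f x + g x).
Proof. apply (Cc_binary Rplus); [binary | lra]. Qed.

Lemma Cc_minus f g : Cc f -> Cc g -> Cc (fun x => f x - g x).
Proof. apply (Cc_binary Rminus); [binary | lra]. Qed.

Lemma Cc_min f g : Cc f -> Cc g -> Cc (fun x => Rmin (f x) (g x)).
Proof. apply (Cc_binary Rmin); [binary | apply Rmin_left; lra]. Qed.

Lemma Cc_max f g : Cc f -> Cc g -> Cc (fun x => Rmax (f x) (g x)).
Proof. apply (Cc_binary Rmax); [binary | apply Rmax_left; lra]. Qed.

Lemma Cc_bounded f : Cc f -> exists M, 0 <= M /\ forall x, Rabs (f x) <= M.
Proof.
  intros [Hf HK].
  assert (H : exists M, 0 <= M /\ forall x, support f x -> Rabs (f x) <= M).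
  - apply (compact_ind _ (fun A => exists M, 0 <= M /\ forall x, A x -> Rabs (f x) <= M) HK).
    + exists 0; split; [lra | tauto].
    + intros A B [M [H1 H2]] [N [H3 H4]]; exists (M + N); split; [lra|].
      intros x [Ax | Bx]; [specialize (H2 x Ax) | specialize (H4 x Bx)]; lra.
    + intros A B HAB [M [H1 H2]]; exists M; auto.
    + intros x _. destruct (proj1 (continuous_pointwise f) Hf x 1) as [U [HU [Ux HUd]]]; [lra|].
      exists U; split; [|split]; auto. exists (Rabs (f x) + 1).
      split; [pose proof (Rabs_pos (f x)); lra|].
      intros y Uy; specialize (HUd y Uy). pose proof (Rabs_triang (f y - f x) (f x)).
      replace (f y - f x + f x) with (f y) in * by lra. lra.
  - destruct H as [M [H1 H2]]; exists M; split; auto. intro x.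
    destruct (Req_dec (f x) 0) as [E | E]; [rewrite E, Rabs_R0; auto|].
    apply H2, subset_closure, E.
Qed.

Lemma open_superlevel f t : Cc f -> op (fun x => t < f x).
Proof.
  intros [Hf _]; apply open_local; auto; intros x Hx.
  destruct (proj1 (continuous_pointwise f) Hf x (f x - t)) as [U [HU [Ux HUd]]]; [lra|].
  exists U; split; [|split]; auto. intros y Uy; specialize (HUd y Uy).
  apply Rabs_def2 in HUd; lra.
Qed.

Lemma compact_superlevel f t : Cc f -> 0 < t -> compact (fun x => t <= f x).
Proof.
  intros Hf Ht; apply (compact_subset (support f)); auto.
  - apply Hf.
  - unfold closed. replace (fun x => ~ t <= f x) with (fun x => - t < - f x).
    + apply (open_superlevel (fun x => - f x)), Cc_opp, Hf.
    + apply set_ext; intro x; lra.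
  - intros x Hx; apply subset_closure; lra.
Qed.

Lemma in_O_superlevel f t : Cc f -> 0 <= t -> in_O X op (fun x => t < f x).
Proof.
  intros Hf Ht; split; [apply open_superlevel, Hf|].
  apply (compact_closure_sub _ (support f)); [apply Hf|].
  intros x Hx; apply subset_closure; lra.
Qed.

Lemma Cc_eq_zero f x : ~ support f x -> f x = 0.
Proof. intro H; apply NNPP; intro E; apply H, subset_closure, E. Qed.

(** * The quasi-integral of a topological measure *)

Section FromMeasure.
Variable tau : set -> R.
Hypothesis Htau : topological_measure X op tau.

Lemma tau_nonneg A : in_A X op A -> 0 <= tau A.
Proof. apply (proj1 Htau). Qed.

Lemma tau_add A A' : in_A X op A -> in_A X op A' -> (forall x, ~ (A x /\ A' x)) ->
  in_A X op (fun x => A x \/ A' x) -> tau (fun x => A x \/ A' x) = tau A + tau A'.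
Proof. apply (proj1 (proj2 Htau)). Qed.

Lemma tau_mono A A' : in_A X op A -> in_A X op A' -> (forall x, A x -> A' x) -> tau A <= tau A'.
Proof. apply (proj1 (proj2 (proj2 Htau))). Qed.

Lemma tau_empty : tau (fun _ => False) = 0.
Proof.
  assert (HA : in_A X op (fun _ => False)) by (left; apply compact_empty).
  assert (E : (fun _ : X => False \/ False) = (fun _ => False))
    by (apply set_ext; intro x; tauto).
  assert (H : tau (fun _ => False \/ False) = tau (fun _ => False) + tau (fun _ => False))
    by (apply tau_add; try rewrite E; auto; tauto).
  rewrite E in H; lra.
Qed.

(** * The integral of the positive part *)

Definition level (g : X -> R) (t : R) : R := tau (fun x => t <= g x).

(** Positivity of [t] recurs below because for [t <= 0] the set need not be compact; integrals
    starting at 0 do not see these values. *)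
Lemma level_in_A g t : Cc g -> 0 < t -> in_A X op (fun x => t <= g x).
Proof. intros; left; apply compact_superlevel; auto. Qed.

Lemma level_mono f g s t : Cc f -> Cc g -> 0 < s -> 0 < t ->
  (forall x, s <= f x -> t <= g x) -> level f s <= level g t.
Proof. intros; apply tau_mono; auto using level_in_A. Qed.

Lemma level_bound f (K : set) t : Cc f -> compact K -> 0 < t ->
  (forall x, t <= f x -> K x) -> 0 <= level f t <= tau K.
Proof.
  intros; split; [apply tau_nonneg, level_in_A; auto|].
  apply tau_mono; auto using level_in_A. left; auto.
Qed.

Lemma level_bound_support f t : Cc f -> 0 < t -> 0 <= level f t <= tau (support f).
Proof.
  intros Hf Ht; apply level_bound; auto; [apply Hf|].
  intros x Hx; apply subset_closure; lra.
Qed.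

Lemma level_empty g t : (forall x, ~ t <= g x) -> level g t = 0.
Proof.
  intro H; rewrite <- tau_empty; unfold level; f_equal; apply set_ext; firstorder.
Qed.

Lemma level_ext f g s t : (forall x, s <= f x <-> t <= g x) -> level f s = level g t.
Proof. intro H; unfold level; f_equal; apply set_ext, H. Qed.

Lemma ex_RInt_level g M : Cc g -> 0 <= M -> ex_RInt (level g) 0 M.
Proof.
  intros Hg HM; apply ex_RInt_decreasing with (tau (support g)); auto.
  - intros; apply level_bound_support; auto; lra.
  - intros; apply level_mono; auto; try lra. intros; lra.
Qed.

Lemma is_RInt_level_extend g M M' I : 0 <= M <= M' -> (forall x, g x <= M) ->
  is_RInt (level g) 0 M I -> is_RInt (level g) 0 M' I.
Proof.
  intros HM Hg HI. replace I with (I + (M' - M) * 0) by lra.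
  apply (is_RInt_Chasles (V := R_NormedModule)) with M; auto.
  apply is_RInt_ext_le with (fun _ => 0); [lra| |apply is_RInt_const_R].
  intros t Ht; symmetry; apply level_empty; intros x; specialize (Hg x); lra.
Qed.

(* The integral of [max g 0]: only the part of [g] above [0] contributes. *)
Definition pos_integral (g : X -> R) : R :=
  epsilon (inhabits 0) (fun I => forall M, 0 <= M -> (forall x, g x <= M) ->
    is_RInt (level g) 0 M I).

Lemma is_RInt_pos_integral g M : Cc g -> 0 <= M -> (forall x, g x <= M) ->
  is_RInt (level g) 0 M (pos_integral g).
Proof.
  intro Hg; revert M.
  apply (epsilon_spec (inhabits 0) (fun I => forall M, 0 <= M -> (forall x, g x <= M) ->
    is_RInt (level g) 0 M I)).
  destruct (Cc_bounded g Hg) as [B [HB HgB]].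
  assert (HgB' : forall x, g x <= B)
    by (intro x; specialize (HgB x); pose proof (Rle_abs (g x)); lra).
  destruct (ex_RInt_level g B Hg HB) as [I HI]; exists I; intros M HM HgM.
  (* The value is independent of the bound, since [level g] vanishes beyond any bound of [g]. *)
  destruct (Rle_lt_dec B M) as [H | H].
  - apply is_RInt_level_extend with B; auto.
  - destruct (ex_RInt_level g M Hg HM) as [J HJ].
    replace I with J; auto. apply (is_RInt_inj (level g) 0 B); auto.
    apply is_RInt_level_extend with M; auto; lra.
Qed.

Lemma common_bound f g : Cc f -> Cc g ->
  exists M, 0 <= M /\ (forall x, f x <= M) /\ (forall x, g x <= M).
Proof.
  intros Hf Hg; destruct (Cc_bounded f Hf) as [B [HB HfB]].
  destruct (Cc_bounded g Hg) as [B' [HB' HgB]]. exists (B + B').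
  split; [lra|]; split; intro x; [specialize (HfB x) | specialize (HgB x)];
    [pose proof (Rle_abs (f x)) | pose proof (Rle_abs (g x))]; lra.
Qed.

Lemma pos_integral_mono f g :
  Cc f -> Cc g -> (forall x, f x <= g x) -> pos_integral f <= pos_integral g.
Proof.
  intros Hf Hg Hfg; destruct (common_bound f g Hf Hg) as [M [HM [HfM HgM]]].
  apply (is_RInt_le (level f) (level g) 0 M); auto using is_RInt_pos_integral.
  intros t Ht; apply level_mono; auto; try lra. intros x; specialize (Hfg x); lra.
Qed.

Lemma pos_integral_nonpos g : Cc g -> (forall x, g x <= 0) -> pos_integral g = 0.
Proof.
  intros Hg H. apply (is_RInt_inj (level g) 0 0); [apply is_RInt_pos_integral; auto; lra|].
  apply (is_RInt_point (V := R_NormedModule)).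
Qed.

(** Levels of [f] below [c] contribute at most [tau K] each. Above [c], [t <= f x] forces
    [t - c <= g x], so the rest is dominated by a translate of the integral of [g]. *)
Lemma pos_integral_lipschitz f g (K : set) c :
  Cc f -> Cc g -> compact K -> supported_in X op f K -> 0 <= c ->
  (forall x, f x <= g x + c) -> pos_integral f <= pos_integral g + tau K * c.
Proof.
  intros Hf Hg HK HfK Hc Hfg; destruct (common_bound f g Hf Hg) as [M [HM [HfM HgM]]].
  destruct (is_RInt_split (level f) 0 c (M + c) (pos_integral f)) as [I1 [I2 [H1 [H2 ->]]]];
    [lra | apply is_RInt_pos_integral; auto; [lra | intro x; specialize (HfM x); lra] |].
  assert (I1 <= (c - 0) * tau K).
  { apply (is_RInt_le (level f) (fun _ => tau K) 0 c); auto using is_RInt_const_R.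
    intros t Ht; apply level_bound; auto; try lra.
    intros x Hx; apply HfK, subset_closure; lra. }
  assert (I2 <= pos_integral g); [|lra].
  apply (is_RInt_le (level f) (fun t => level g (t - c)) c (M + c)); auto; [lra| |].
  - replace c with (0 + c) at 1 by lra. apply is_RInt_shift, is_RInt_pos_integral; auto.
  - intros t Ht; apply level_mono; auto; try lra. intros x Hx; specialize (Hfg x); lra.
Qed.

Lemma pos_integral_scal c g :
  Cc g -> 0 < c -> pos_integral (fun x => c * g x) = c * pos_integral g.
Proof.
  intros Hg Hc; destruct (common_bound g g Hg Hg) as [M [HM [HgM _]]].
  apply (is_RInt_inj (level (fun x => c * g x)) 0 (c * M)).
  - apply is_RInt_pos_integral; auto using Cc_scal; [nra|].
    intro x; specialize (HgM x); nra.
  - apply is_RInt_ext_le with (fun t => level g (t / c)); [nra| |].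
    + intros t Ht; apply level_ext; intro x; rewrite (Rmult_comm c). split; intro H;
      apply Rle_div_l; auto.
    + apply is_RInt_dilate, is_RInt_pos_integral; auto.
Qed.

(* Replacing [<=] by [<] changes the integrand only at its countably many jumps; squeezing
   between translates avoids talking about them. *)
Lemma is_RInt_strict_level g M : Cc g -> 0 <= M -> (forall x, g x <= M) ->
  is_RInt (fun t => tau (fun x => t < g x)) 0 M (pos_integral g).
Proof.
  intros Hg HM HgM. set (C := tau (support g)).
  assert (HinO : forall t, 0 < t -> in_A X op (fun x => t < g x))
    by (intros; right; apply in_O_superlevel; auto; lra).
  assert (Hle : forall t, 0 < t -> tau (fun x => t < g x) <= level g t)
    by (intros t Ht; apply tau_mono; auto using level_in_A; intros; lra).
  destruct (ex_RInt_decreasing (fun t => tau (fun x => t < g x)) 0 M C) as [J HJ]; auto.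
  { intros t Ht; split; [apply tau_nonneg, HinO; lra|].
    apply Rle_trans with (level g t); [apply Hle; lra | apply level_bound_support; auto; lra]. }
  { intros s t Hst Ht; apply tau_mono; try apply HinO; try lra. intros; lra. }
  replace (pos_integral g) with J; auto.
  apply Rle_antisym.
  - apply (is_RInt_le (fun t => tau (fun x => t < g x)) (level g) 0 M);
      auto using is_RInt_pos_integral. intros t Ht; apply Hle; lra.
  - assert (HC : 0 <= C) by (apply tau_nonneg; left; apply Hg).
    apply le_epsilon; intros eps Heps.
    (* Translating by [d] loses only the integral over [(0, d)], at most [d * C]. *)
    set (d := eps / (C + 1)).
    assert (Hd : 0 < d) by (apply Rdiv_lt_0_compat; lra).
    destruct (is_RInt_split (level g) 0 d (M + d) (pos_integral g)) as [I1 [I2 [H1 [H2 ->]]]];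
      [lra | apply is_RInt_pos_integral; auto; [lra | intro x; specialize (HgM x); lra] |].
    assert (I1 <= (d - 0) * C).
    { apply (is_RInt_le (level g) (fun _ => C) 0 d); auto using is_RInt_const_R; [lra|].
      intros t Ht; apply level_bound_support; auto; lra. }
    assert (I2 <= J).
    { apply (is_RInt_le (level g) (fun t => tau (fun x => t - d < g x)) d (M + d)); auto; [lra| |].
      - assert (HS := is_RInt_shift (fun t => tau (fun x => t < g x)) 0 M d J HJ).
        rewrite Rplus_0_l in HS; exact HS.
      - intros t Ht; apply tau_mono;
          [apply level_in_A; auto; lra | apply HinO; lra | intros; lra]. }
    assert (d * (C + 1) = eps) by (unfold d; field; lra). nra.
Qed.

(** * The signed integral: monotonicity and Lipschitz bound *)

Definition integral (g : X -> R) : R := pos_integral g - pos_integral (fun x => - g x).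

Lemma integral_opp g : integral (fun x => - g x) = - integral g.
Proof.
  unfold integral. replace (fun x => - - g x) with g; [lra|].
  apply functional_extensionality; intro; lra.
Qed.

Lemma integral_mono f g : Cc f -> Cc g -> (forall x, f x <= g x) -> integral f <= integral g.
Proof.
  intros Hf Hg Hfg; unfold integral.
  pose proof (pos_integral_mono f g Hf Hg Hfg).
  pose proof (pos_integral_mono (fun x => - g x) (fun x => - f x) (Cc_opp g Hg) (Cc_opp f Hf)).
  assert (pos_integral (fun x => - g x) <= pos_integral (fun x => - f x)); [|lra].
  apply H0; intro x; specialize (Hfg x); lra.
Qed.

Lemma supported_in_opp f (K : set) :
  supported_in X op f K -> supported_in X op (fun x => - f x) K.
Proof.
  intros H x Hx; apply H; revert Hx; apply closure_mono; intros y Hy E; apply Hy; rewrite E; lra.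
Qed.

(** The factor 2 counts the positive part and the negative part, each estimated by
    [pos_integral_lipschitz]. *)
Lemma integral_lipschitz f g (K : set) c :
  Cc f -> Cc g -> compact K -> supported_in X op f K -> supported_in X op g K ->
  (forall x, Rabs (f x - g x) <= c) -> Rabs (integral f - integral g) <= 2 * tau K * c.
Proof.
  intros Hf Hg HK HfK HgK Hfg.
  assert (HfgE : forall x, f x <= g x + c /\ g x <= f x + c).
  { intro x; specialize (Hfg x); apply Rabs_le_between in Hfg; lra. }
  destruct (classic (exists x : X, True)) as [[x0 _] | Hempty].
  - assert (Hc : 0 <= c) by (specialize (Hfg x0); pose proof (Rabs_pos (f x0 - g x0)); lra).
    pose proof (pos_integral_lipschitz f g K c Hf Hg HK HfK Hc (fun x => proj1 (HfgE x))).
    pose proof (pos_integral_lipschitz g f K c Hg Hf HK HgK Hc (fun x => proj2 (HfgE x))).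
    pose proof (pos_integral_lipschitz _ _ K c (Cc_opp f Hf) (Cc_opp g Hg) HK
      (supported_in_opp f K HfK) Hc) as H1.
    pose proof (pos_integral_lipschitz _ _ K c (Cc_opp g Hg) (Cc_opp f Hf) HK
      (supported_in_opp g K HgK) Hc) as H2.
    unfold integral; apply Rabs_le. lapply H1; [|intro x; specialize (HfgE x); lra].
    lapply H2; [|intro x; specialize (HfgE x); lra]. lra.
  (* On an empty space [c] may be negative, but then [tau K = 0]. *)
  - replace K with (fun _ : X => False) by (apply set_ext; intro x; exfalso; eauto).
    replace g with f by (apply functional_extensionality; intro x; exfalso; eauto).
    rewrite tau_empty, Rminus_diag, Rabs_R0; lra.
Qed.

(** * Homogeneity and additivity over a plateau *)

Lemma integral_scal c g : Cc g -> integral (fun x => c * g x) = c * integral g.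
Proof.
  intro Hg.
  assert (Hpos : forall c, 0 < c -> integral (fun x => c * g x) = c * integral g).
  { intros d Hd; unfold integral. rewrite pos_integral_scal by auto.
    replace (fun x => - (d * g x)) with (fun x => d * - g x)
      by (apply functional_extensionality; intro; lra).
    rewrite (pos_integral_scal d (fun x => - g x)); auto using Cc_opp; lra. }
  destruct (Rtotal_order c 0) as [H | [-> | H]]; auto.
  - replace (fun x => c * g x) with (fun x => - (- c * g x))
      by (apply functional_extensionality; intro; lra).
    rewrite (integral_opp (fun x => - c * g x)), Hpos; lra.
  - replace (fun x => 0 * g x) with (fun _ : X => 0)
      by (apply functional_extensionality; intro; lra).
    assert (E := integral_opp (fun _ => 0)). simpl in E; rewrite Ropp_0 in E; lra.
Qed.

(** Levels up to [b] do not see [k]. For [t > b] the set where [t <= h + k] is the disjoint union of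
    those where [t <= h] and where [t - b <= k]. As [b >= 0], negative parts are unaffected. *)
Lemma integral_add_above h k b :
  Cc h -> Cc k -> 0 <= b -> (forall x, 0 <= k x) -> (forall x, k x <> 0 -> h x = b) ->
  integral (fun x => h x + k x) = integral h + integral k.
Proof.
  intros Hh Hk Hb Hk0 Hhk.
  assert (Hneg : pos_integral (fun x => - (h x + k x)) = pos_integral (fun x => - h x)).
  { destruct (common_bound _ _ (Cc_opp h Hh) (Cc_opp _ (Cc_plus h k Hh Hk)))
      as [M [HM [HhM HgM]]].
    apply (is_RInt_inj (level (fun x => - h x)) 0 M).
    - apply is_RInt_ext_le with (level (fun x => - (h x + k x))); auto.
      + intros t Ht; apply level_ext; intro x.
        destruct (Req_dec (k x) 0) as [E | E]; [rewrite E, Rplus_0_r; tauto|].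
        specialize (Hhk x E); specialize (Hk0 x); lra.
      + apply is_RInt_pos_integral; auto using Cc_opp, Cc_plus.
    - apply is_RInt_pos_integral; auto using Cc_opp. }
  unfold integral; rewrite Hneg, (pos_integral_nonpos (fun x => - k x)); auto using Cc_opp;
    [|intro x; specialize (Hk0 x); lra].
  assert (pos_integral (fun x => h x + k x) = pos_integral h + pos_integral k); [|lra].
  destruct (common_bound h k Hh Hk) as [M [HM [HhM HkM]]].
  destruct (is_RInt_split (level h) 0 b (M + b) (pos_integral h)) as [I1 [I2 [H1 [H2 ->]]]];
    [lra | apply is_RInt_pos_integral; auto; [lra | intro x; specialize (HhM x); lra] |].
  apply (is_RInt_inj (level (fun x => h x + k x)) 0 (M + b)).
  - apply is_RInt_pos_integral; auto using Cc_plus; [lra|]. intro x.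
    destruct (Req_dec (k x) 0) as [E | E]; [rewrite E; specialize (HhM x); lra|].
    rewrite (Hhk x E); specialize (HkM x); lra.
  - rewrite Rplus_assoc. apply (is_RInt_Chasles (V := R_NormedModule)) with b.
    + apply is_RInt_ext_le with (level h); auto.
      intros t Ht; apply level_ext; intro x.
      destruct (Req_dec (k x) 0) as [E | E]; [rewrite E, Rplus_0_r; tauto|].
      specialize (Hhk x E); specialize (Hk0 x); lra.
    + apply is_RInt_ext_le with (fun t => level h t + level k (t - b)); [lra| |].
      * intros t Ht. unfold level at 1 2; rewrite <- tau_add.
        -- unfold level; f_equal; apply set_ext; intro x.
           destruct (Req_dec (k x) 0) as [E | E]; [rewrite E; lra|].
           specialize (Hhk x E); lra.
        -- apply level_in_A; auto; lra.
        -- apply level_in_A; auto; lra.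
        -- intros x [Hx1 Hx2]. assert (E : k x <> 0) by lra. specialize (Hhk x E); lra.
        -- left; apply compact_union; apply compact_superlevel; auto; lra.
      * apply (is_RInt_plus (V := R_NormedModule)); auto.
        replace b with (0 + b) at 1 by lra.
        apply is_RInt_shift, is_RInt_pos_integral; auto.
Qed.

(** For [0 < t < b] the compact set [t <= h] is the disjoint union of the compact set [t <= h + k]
    and the open set [b - t < - k]. Its measure is integrated by reflecting [t] to [b - t]. The
    bound [- b <= k] keeps [h + k >= 0] over the plateau, so negative parts agree. *)
Lemma integral_add_below h k b :
  Cc h -> Cc k -> (forall x, - b <= k x <= 0) -> 0 <= b -> (forall x, k x <> 0 -> h x = b) ->
  integral (fun x => h x + k x) = integral h + integral k.
Proof.
  intros Hh Hk Hkb Hb Hhk.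
  assert (Hneg : pos_integral (fun x => - (h x + k x)) = pos_integral (fun x => - h x)).
  { destruct (common_bound _ _ (Cc_opp h Hh) (Cc_opp _ (Cc_plus h k Hh Hk)))
      as [M [HM [HhM HgM]]].
    apply (is_RInt_inj (level (fun x => - h x)) 0 M).
    - apply is_RInt_ext_le with (level (fun x => - (h x + k x))); auto.
      + intros t Ht; apply level_ext; intro x.
        destruct (Req_dec (k x) 0) as [E | E]; [rewrite E, Rplus_0_r; tauto|].
        specialize (Hhk x E); specialize (Hkb x); lra.
      + apply is_RInt_pos_integral; auto using Cc_opp, Cc_plus.
    - apply is_RInt_pos_integral; auto using Cc_opp. }
  unfold integral; rewrite Hneg, (pos_integral_nonpos k); auto; [|intro x; apply Hkb].
  assert (pos_integral (fun x => h x + k x)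
          = pos_integral h - pos_integral (fun x => - k x)); [|lra].
  destruct (common_bound h h Hh Hh) as [M [HM [HhM _]]].
  destruct (is_RInt_split (level h) 0 b (M + b) (pos_integral h)) as [I1 [I2 [H1 [H2 ->]]]];
    [lra | apply is_RInt_pos_integral; auto; [lra | intro x; specialize (HhM x); lra] |].
  apply (is_RInt_inj (level (fun x => h x + k x)) 0 (M + b)).
  - apply is_RInt_pos_integral; auto using Cc_plus; [lra|].
    intro x; specialize (HhM x); specialize (Hkb x); lra.
  - replace (I1 + I2 - pos_integral (fun x => - k x))
      with ((I1 - pos_integral (fun x => - k x)) + I2) by lra.
    apply (is_RInt_Chasles (V := R_NormedModule)) with b.
    + apply is_RInt_ext_le with (fun t => level h t - tau (fun x => b - t < - k x)); auto.
      * intros t Ht. enough (E : level h t =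
          level (fun x => h x + k x) t + tau (fun x => b - t < - k x)) by lra.
        unfold level at 2; rewrite <- tau_add.
        -- unfold level; f_equal; apply set_ext; intro x.
           destruct (Req_dec (k x) 0) as [E | E]; [rewrite E; lra|].
           specialize (Hhk x E); lra.
        -- apply level_in_A; auto using Cc_plus; lra.
        -- right; apply in_O_superlevel; auto using Cc_opp; lra.
        -- intros x [Hx1 Hx2]. assert (E : k x <> 0) by lra. specialize (Hhk x E); lra.
        -- left. replace (fun x => t <= h x + k x \/ b - t < - k x) with (fun x => t <= h x).
           ++ apply compact_superlevel; auto; lra.
           ++ apply set_ext; intro x.
              destruct (Req_dec (k x) 0) as [E | E]; [rewrite E; lra|].
              specialize (Hhk x E); lra.
      * apply (is_RInt_minus (V := R_NormedModule)); auto.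
        apply (is_RInt_reflect (fun t => tau (fun x => t < - k x))).
        apply is_RInt_strict_level; auto using Cc_opp. intro x; specialize (Hkb x); lra.
    + apply is_RInt_ext_le with (level h); auto; [lra|].
      intros t Ht; apply level_ext; intro x.
      destruct (Req_dec (k x) 0) as [E | E]; [rewrite E, Rplus_0_r; tauto|].
      specialize (Hhk x E); specialize (Hkb x); lra.
Qed.

(* [k] is cut at the heights [0] and [- b]: the pieces add to [h] one after the other, first
   lifting the plateau [b] of [h], then digging it down to [0], then below [0]. *)
Lemma integral_add_const_nonneg h k b :
  Cc h -> Cc k -> 0 <= b -> (forall x, k x <> 0 -> h x = b) ->
  integral (fun x => h x + k x) = integral h + integral k.
Proof.
  intros Hh Hk Hb Hhk.
  set (k1 := fun x => Rmax (k x) 0).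
  set (k2 := fun x => Rmax (Rmin (k x) 0) (- b)).
  set (k3 := fun x => Rmin (k x + b) 0).
  assert (Hk1 : Cc k1) by (apply Cc_max; auto using Cc_zero).
  assert (Hk2 : Cc k2).
  { apply (Cc_comp (fun s => Rmax (Rmin s 0) (- b))); auto.
    - lipschitz_one.
    - unfold Rmax, Rmin; repeat destruct Rle_dec; lra. }
  assert (Hk3 : Cc k3).
  { apply (Cc_comp (fun s => Rmin (s + b) 0)); auto.
    - lipschitz_one.
    - unfold Rmin; repeat destruct Rle_dec; lra. }
  assert (Hcase : forall x,
    (0 <= k x /\ k1 x = k x /\ k2 x = 0 /\ k3 x = 0) \/
    (- b <= k x < 0 /\ k1 x = 0 /\ k2 x = k x /\ k3 x = 0) \/
    (k x < - b /\ k1 x = 0 /\ k2 x = - b /\ k3 x = k x + b)).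
  { intro x; unfold k1, k2, k3, Rmax, Rmin; repeat destruct Rle_dec; lra. }
  clearbody k1 k2 k3.
  assert (E1 : integral (fun x => h x + k1 x) = integral h + integral k1).
  { apply integral_add_above with b; auto.
    - intro x; destruct (Hcase x) as [H | [H | H]]; lra.
    - intros x Hx; apply Hhk; destruct (Hcase x) as [H | [H | H]]; lra. }
  assert (E2 : integral (fun x => h x + k1 x + k2 x)
               = integral (fun x => h x + k1 x) + integral k2).
  { apply (integral_add_below (fun x => h x + k1 x) k2 b); auto using Cc_plus.
    - intro x; destruct (Hcase x) as [H | [H | H]]; lra.
    - intros x Hx; destruct (Hcase x) as [H | [H | H]]; rewrite ?(Hhk x); lra. }
  (* Where [k3] does not vanish, [h + k1 + k2] is 0; passing to opposites turns digging below 0 into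
     raising above a plateau at 0. *)
  assert (E3 : integral (fun x => - (h x + k1 x + k2 x) + - k3 x)
               = integral (fun x => - (h x + k1 x + k2 x)) + integral (fun x => - k3 x)).
  { apply (integral_add_above (fun x => - (h x + k1 x + k2 x)) (fun x => - k3 x) 0);
      auto using Cc_plus, Cc_opp; [lra | |].
    - intro x; destruct (Hcase x) as [H | [H | H]]; lra.
    - intros x Hx; destruct (Hcase x) as [H | [H | H]]; rewrite ?(Hhk x); lra. }
  (* The same cuts must also compute the integral of [k] itself: [k1] sits on the zero plateau of
     [k2 + k3], and [- k3] on the plateau [b] of [- k2]. *)
  assert (F1 : integral (fun x => (k2 x + k3 x) + k1 x)
               = integral (fun x => k2 x + k3 x) + integral k1).
  { apply (integral_add_above (fun x => k2 x + k3 x) k1 0); auto using Cc_plus; [lra | |].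
    - intro x; destruct (Hcase x) as [H | [H | H]]; lra.
    - intros x Hx; destruct (Hcase x) as [H | [H | H]]; lra. }
  assert (F2 : integral (fun x => - k2 x + - k3 x)
               = integral (fun x => - k2 x) + integral (fun x => - k3 x)).
  { apply (integral_add_above (fun x => - k2 x) (fun x => - k3 x) b); auto using Cc_opp.
    - intro x; destruct (Hcase x) as [H | [H | H]]; lra.
    - intros x Hx; destruct (Hcase x) as [H | [H | H]]; lra. }
  replace (fun x => - (h x + k1 x + k2 x) + - k3 x) with (fun x => - (h x + k x)) in E3
    by (apply functional_extensionality; intro x;
        destruct (Hcase x) as [H | [H | H]]; lra).
  replace (fun x => - k2 x + - k3 x) with (fun x => - (k2 x + k3 x)) in F2
    by (apply functional_extensionality; intro x; lra).
  replace (fun x => (k2 x + k3 x) + k1 x) with k in F1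
    by (apply functional_extensionality; intro x;
        destruct (Hcase x) as [H | [H | H]]; lra).
  rewrite (integral_opp (fun x => h x + k x)), (integral_opp (fun x => h x + k1 x + k2 x)),
    integral_opp in E3.
  rewrite (integral_opp (fun x => k2 x + k3 x)), !integral_opp in F2. lra.
Qed.

Lemma integral_add_const h k b :
  Cc h -> Cc k -> (forall x, k x <> 0 -> h x = b) ->
  integral (fun x => h x + k x) = integral h + integral k.
Proof.
  intros Hh Hk Hhk. destruct (Rle_lt_dec 0 b) as [Hb | Hb];
    [apply (integral_add_const_nonneg h k b); auto|].
  assert (E := integral_add_const_nonneg (fun x => - h x) (fun x => - k x) (- b)
                 (Cc_opp h Hh) (Cc_opp k Hk) ltac:(lra)).
  simpl in E. replace (fun x => - h x + - k x) with (fun x => - (h x + k x)) in E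
    by (apply functional_extensionality; intro x; lra).
  rewrite (integral_opp (fun x => h x + k x)), !integral_opp in E.
  assert (E' : - integral (fun x => h x + k x) = - integral h + - integral k); [|lra].
  apply E; intros x Hx; rewrite Hhk; lra.
Qed.

(** * Piecewise linear approximation and quasi-linearity *)

Definition ramp (w : R) (i : nat) (s : R) : R := Rmax 0 (Rmin 1 (s * w - INR i)).

Lemma ramp_continuity w i : 0 < w -> continuity (ramp w i).
Proof.
  intro Hw; apply (lipschitz_continuity _ w); intros s t.
  apply Rle_trans with (Rabs (s * w - t * w)).
  - unfold ramp, Rmax, Rmin, Rabs; repeat destruct Rle_dec; repeat destruct Rcase_abs; lra.
  - rewrite <- Rmult_minus_distr_r, Rabs_mult, (Rabs_pos_eq w); lra.
Qed.

Lemma ramp_low w i s : s * w <= INR i -> ramp w i s = 0.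
Proof. intro H; unfold ramp, Rmax, Rmin; repeat destruct Rle_dec; lra. Qed.

Lemma ramp_high w i s : INR (S i) <= s * w -> ramp w i s = 1.
Proof.
  rewrite S_INR; intro H; unfold ramp, Rmax, Rmin; repeat destruct Rle_dec; lra.
Qed.

Lemma ramp_mid w i s : INR i <= s * w <= INR (S i) -> ramp w i s = s * w - INR i.
Proof.
  rewrite S_INR; intro H; unfold ramp, Rmax, Rmin; repeat destruct Rle_dec; lra.
Qed.

Lemma ramp_zero w i : ramp w i 0 = 0.
Proof. apply ramp_low; rewrite Rmult_0_l; apply pos_INR. Qed.

Lemma Cc_ramp w i g : 0 < w -> Cc g -> Cc (fun x => ramp w i (g x)).
Proof. intros; apply Cc_comp; auto using ramp_continuity, ramp_zero. Qed.

Definition increment (chi : R -> R) (w : R) (i : nat) : R :=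
  chi (INR (S i) / w) - chi (INR i / w).

(** The piecewise linear interpolation of [chi] at the nodes [i / w]: [ramp w i] climbs from 0 to 1
    between nodes [i] and [i + 1] and stays at 1, so the increments telescope. *)
Definition interpolant (chi : R -> R) (w : R) (m : nat) (s : R) : R :=
  sum_f_R0 (fun i => increment chi w i * ramp w i s) m.

Lemma interpolant_zero chi w m : interpolant chi w m 0 = 0.
Proof.
  unfold interpolant; induction m as [|m IH]; [|rewrite tech5, IH]; cbn [sum_f_R0];
    rewrite ramp_zero; lra.
Qed.

(** Between two nodes the interpolant is a convex combination of the values of [chi] there, and both
    nodes are within [/ w] of [s]. The first conclusion carries the telescoped value through the
    induction. *)
Lemma interpolant_approx chi w eps B m s :
  0 < w -> chi 0 = 0 ->
  (forall s t, 0 <= s <= B -> 0 <= t <= B -> Rabs (s - t) <= / w ->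
     Rabs (chi s - chi t) <= eps) ->
  INR (S m) / w <= B -> 0 <= s <= B ->
  (INR (S m) <= s * w -> interpolant chi w m s = chi (INR (S m) / w)) /\
  (s * w <= INR (S m) -> Rabs (interpolant chi w m s - chi s) <= eps).
Proof.
  intros Hw H0 Hosc HB Hs; unfold interpolant, increment.
  assert (Hmid : forall i, INR (S i) / w <= B -> INR i <= s * w <= INR (S i) ->
    Rabs (chi (INR i / w) + (chi (INR (S i) / w) - chi (INR i / w)) * ramp w i s - chi s)
      <= eps).
  { intros i HiB Hi; rewrite ramp_mid by auto. rewrite S_INR in *.
    assert (Hi1 : 0 <= INR i / w) by (apply Rdiv_le_0_compat; auto using pos_INR).
    assert (E : (INR i + 1) / w = INR i / w + / w) by (field; lra).
    assert (Hw' : 0 < / w) by (apply Rinv_0_lt_compat, Hw).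
    assert (Es : s = s * w / w) by (field; lra).
    assert (H1 : INR i / w <= s <= INR i / w + / w).
    { rewrite <- E, Es; unfold Rdiv; split; apply Rmult_le_compat_r; lra. }
    assert (A1 := Hosc (INR i / w) s ltac:(lra) Hs ltac:(apply Rabs_le; lra)).
    assert (A2 := Hosc ((INR i + 1) / w) s ltac:(lra) Hs ltac:(apply Rabs_le; lra)).
    apply Rabs_le_between in A1; apply Rabs_le_between in A2.
    set (r := s * w - INR i) in *. assert (0 <= r <= 1) by (unfold r; lra).
    apply Rabs_le; split; nra. }
  induction m as [|m IH].
  - assert (E0 : chi (INR 0 / w) = 0)
      by (replace (INR 0 / w) with 0 by (simpl; field; lra); auto).
    cbn [sum_f_R0]; split; intro H.
    + rewrite ramp_high by auto. rewrite E0; lra.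
    + specialize (Hmid 0%nat HB). rewrite E0 in *; rewrite Rplus_0_l in Hmid.
      apply Hmid; split; auto; simpl; nra.
  - rewrite tech5. destruct IH as [IH1 IH2].
    { apply Rle_trans with (2 := HB). unfold Rdiv; apply Rmult_le_compat_r;
        [apply Rlt_le, Rinv_0_lt_compat, Hw | apply le_INR; lia]. }
    split; intro H.
    + rewrite ramp_high by auto. rewrite IH1; [lra|].
      rewrite (S_INR (S m)) in H; lra.
    + destruct (Rle_lt_dec (INR (S m)) (s * w)) as [H' | H'].
      * rewrite IH1 by auto. apply Hmid; auto.
      * rewrite ramp_low by lra. rewrite Rmult_0_r, Rplus_0_r; apply IH2; lra.
Qed.

Lemma Cc_sum_ramp (c : nat -> R) w g m :
  0 < w -> Cc g -> Cc (fun x => sum_f_R0 (fun i => c i * ramp w i (g x)) m).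
Proof.
  intros Hw Hg; induction m as [|m IH]; simpl;
    [|apply Cc_plus; auto]; apply (Cc_scal (c _)), Cc_ramp; auto.
Qed.

(** Where ramp [m + 1] is nonzero all earlier ramps are saturated at 1, so the partial sum has the
    plateau value [sum_f_R0 c m] there, as [integral_add_const] demands. *)
Lemma integral_sum_ramp (c : nat -> R) w g m : 0 < w -> Cc g ->
  integral (fun x => sum_f_R0 (fun i => c i * ramp w i (g x)) m) =
  sum_f_R0 (fun i => c i * integral (fun x => ramp w i (g x))) m.
Proof.
  intros Hw Hg; induction m as [|m IH].
  - apply (integral_scal (c 0%nat) (fun x => ramp w 0 (g x))), Cc_ramp; auto.
  - rewrite tech5, <- IH, <- (integral_scal (c (S m)) (fun x => ramp w (S m) (g x)))
      by (apply Cc_ramp; auto).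
    apply (integral_add_const (fun x => sum_f_R0 (fun i => c i * ramp w i (g x)) m)
             (fun x => c (S m) * ramp w (S m) (g x)) (sum_f_R0 c m));
      [apply Cc_sum_ramp; auto | apply (Cc_scal (c (S m))), Cc_ramp; auto |].
    intros x Hx. assert (H : INR (S m) < g x * w).
    { apply Rnot_le_lt; intro H; apply Hx; rewrite ramp_low by auto; lra. }
    apply sum_eq; intros i Hi. rewrite ramp_high; [lra|].
    apply Rlt_le, Rle_lt_trans with (2 := H), le_INR; lia.
Qed.

Lemma supported_in_comp (phi : R -> R) f :
  phi 0 = 0 -> supported_in X op (fun x => phi (f x)) (support f).
Proof.
  intros H0 x; apply closure_mono; intros y Hy E; apply Hy; rewrite E; auto.
Qed.

(** With [w = (m + 1) / M] the [m + 1] ramps exactly cover [[0, M]]. The approximating sum depends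
    on [chi] only through its increments, hence linearly, while the integrals of the ramps are the
    same for every [chi]; linearity then survives in the limit. *)
Lemma integral_comp_limit chi g M :
  continuity chi -> chi 0 = 0 -> Cc g -> 0 < M -> (forall x, 0 <= g x <= M) ->
  Un_cv (fun m => sum_f_R0 (fun i => increment chi (INR (S m) / M) i *
                    integral (fun x => ramp (INR (S m) / M) i (g x))) m)
        (integral (fun x => chi (g x))).
Proof.
  intros Hchi H0 Hg HM HgM eps Heps.
  set (N := 2 * tau (support g)).
  assert (HN : 0 <= N).
  { assert (0 <= tau (support g)) by (apply tau_nonneg; left; apply Hg). unfold N; lra. }
  assert (He : 0 < eps / (N + 1)) by (apply Rdiv_lt_0_compat; lra).
  destruct (Heine_cor2 (f := chi) (a := 0) (b := M) (fun x _ => Hchi x) (mkposreal _ He))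
    as [d Hd]; simpl in Hd.
  destruct (nfloor_ex (M / d)) as [n [_ Hn]];
    [apply Rlt_le, Rdiv_lt_0_compat; [lra | apply cond_pos]|].
  exists n; intros m Hm. set (w := INR (S m) / M).
  assert (HSm : 0 < INR (S m)) by (apply lt_0_INR; lia).
  assert (Hw : 0 < w) by (apply Rdiv_lt_0_compat; auto).
  assert (HwM : INR (S m) / w = M) by (unfold w; field; lra).
  assert (Hwd : / w < d).
  { apply Rlt_div_l in Hn; [|apply cond_pos].
    assert (INR (S n) <= INR (S m)) by (apply le_INR; lia). rewrite (S_INR n) in H.
    pose proof (cond_pos d).
    unfold w; rewrite Rinv_div. apply Rlt_div_l; auto; nra. }
  unfold Rdist. rewrite <- integral_sum_ramp by auto.
  apply Rle_lt_trans with (N * (eps / (N + 1))).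
  - apply (integral_lipschitz _ _ (support g)).
    + apply Cc_sum_ramp; auto.
    + apply Cc_comp; auto.
    + apply Hg.
    + apply (supported_in_comp (interpolant chi w m)). apply interpolant_zero.
    + apply supported_in_comp; auto.
    + intro x. destruct (interpolant_approx chi w (eps / (N + 1)) M m (g x)) as [_ H]; auto.
      * intros s t Hs Ht Hst; apply Rlt_le, Hd; auto; lra.
      * lra.
      * apply H. specialize (HgM x). apply Rle_div_r; auto. lra.
  - unfold Rdiv. rewrite (Rmult_comm eps), <- Rmult_assoc.
    assert (N * / (N + 1) < 1) by (apply Rlt_div_l; lra). nra.
Qed.

Lemma integral_quasilinear_nonneg g phi psi a b :
  Cc g -> (forall x, 0 <= g x) ->
  continuity phi -> phi 0 = 0 -> continuity psi -> psi 0 = 0 ->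
  integral (fun x => a * phi (g x) + b * psi (g x)) =
  a * integral (fun x => phi (g x)) + b * integral (fun x => psi (g x)).
Proof.
  intros Hg Hg0 Hphi Hphi0 Hpsi Hpsi0.
  destruct (Cc_bounded g Hg) as [M [HM HgM]].
  assert (HgM' : forall x, 0 <= g x <= M + 1).
  { intro x; specialize (HgM x); specialize (Hg0 x); rewrite Rabs_pos_eq in HgM; lra. }
  assert (L1 := integral_comp_limit phi g (M + 1) Hphi Hphi0 Hg ltac:(lra) HgM').
  assert (L2 := integral_comp_limit psi g (M + 1) Hpsi Hpsi0 Hg ltac:(lra) HgM').
  assert (L3 := integral_comp_limit (fun s => a * phi s + b * psi s) g (M + 1)).
  simpl in L3. eapply UL_sequence; [apply L3; auto; try lra|].
  - apply continuity_plus; apply continuity_scal; auto.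
  - rewrite Hphi0, Hpsi0; lra.
  - assert (Hcst : forall c, Un_cv (fun _ => c) c)
      by (intros c e He; exists 0%nat; intros _ _; rewrite Rdist_eq; auto).
    assert (L4 := CV_plus _ _ _ _ (CV_mult _ _ _ _ (Hcst a) L1) (CV_mult _ _ _ _ (Hcst b) L2)).
    intros e He; destruct (L4 e He) as [n Hn]; exists n; intros m Hm.
    specialize (Hn m Hm); simpl in Hn. rewrite !scal_sum, <- plus_sum in Hn.
    erewrite sum_eq; [exact Hn|]. intros i _; unfold increment; simpl; lra.
Qed.

(** Reduces quasi-linearity to nonnegative functions: the two summands are never both nonzero, so
    this is additivity over a plateau at height 0. *)
Lemma integral_comp_split f chi : Cc f -> continuity chi -> chi 0 = 0 ->
  integral (fun x => chi (f x)) =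
  integral (fun x => chi (Rmax (f x) 0)) + integral (fun x => chi (- Rmax (- f x) 0)).
Proof.
  intros Hf Hchi H0.
  rewrite <- (integral_add_const (fun x => chi (Rmax (f x) 0))
                (fun x => chi (- Rmax (- f x) 0)) 0).
  - f_equal; apply functional_extensionality; intro x.
    destruct (Rle_lt_dec 0 (f x)).
    + rewrite Rmax_left, Rmax_right, Ropp_0, H0 by lra; lra.
    + rewrite Rmax_right, Rmax_left, Ropp_involutive, H0 by lra; lra.
  - apply (Cc_comp chi (fun x => Rmax (f x) 0)); auto using Cc_max, Cc_zero.
  - apply (Cc_comp chi (fun x => - Rmax (- f x) 0)); auto.
    apply (Cc_opp (fun x => Rmax (- f x) 0)), Cc_max; auto using Cc_opp, Cc_zero.
  - intros x Hx. destruct (Rle_lt_dec 0 (f x)).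
    + exfalso; apply Hx. rewrite Rmax_right, Ropp_0 by lra; auto.
    + rewrite Rmax_right by lra; auto.
Qed.

Lemma integral_quasilinear f phi psi a b :
  Cc f -> continuity phi -> phi 0 = 0 -> continuity psi -> psi 0 = 0 ->
  integral (fun x => a * phi (f x) + b * psi (f x)) =
  a * integral (fun x => phi (f x)) + b * integral (fun x => psi (f x)).
Proof.
  intros Hf Hphi Hphi0 Hpsi Hpsi0.
  rewrite (integral_comp_split f (fun s => a * phi s + b * psi s)); auto.
  - rewrite (integral_comp_split f phi), (integral_comp_split f psi) by auto.
    assert (Hopp : forall chi, continuity chi -> continuity (fun s => chi (- s))).
    { intros chi H. apply (continuity_comp Ropp chi); auto.
      apply (lipschitz_continuity _ 1). intros s t. rewrite <- Rabs_Ropp. right.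
      rewrite Rmult_1_l; f_equal; lra. }
    rewrite (integral_quasilinear_nonneg (fun x => Rmax (f x) 0));
      auto using Cc_max, Cc_zero, Rmax_r.
    rewrite (integral_quasilinear_nonneg (fun x => Rmax (- f x) 0)
               (fun s => phi (- s)) (fun s => psi (- s)));
      auto using Cc_max, Cc_opp, Cc_zero, Rmax_r; rewrite ?Ropp_0; auto.
    lra.
  - apply continuity_plus; apply continuity_scal; auto.
  - rewrite Hphi0, Hpsi0; lra.
Qed.

Lemma quasi_integral_integral : quasi_integral X op integral.
Proof.
  split; [|split].
  - apply integral_mono.
  - intros K HK; exists (2 * tau K); split.
    + assert (0 <= tau K) by (apply tau_nonneg; left; auto). lra.
    + intros; apply integral_lipschitz; auto.
  - intros; apply integral_quasilinear; auto.
Qed.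

(** * Recovery of the measure from its integral *)

Lemma pos_integral_nonneg g : Cc g -> 0 <= pos_integral g.
Proof.
  intro Hg. rewrite <- (pos_integral_nonpos _ Cc_zero) by (intros; lra).
  destruct (common_bound g g Hg Hg) as [M [HM [HgM _]]].
  apply (is_RInt_le (level (fun _ => 0)) (level g) 0 M); auto;
    [apply is_RInt_pos_integral; auto using Cc_zero | apply is_RInt_pos_integral; auto |].
  intros t Ht. rewrite level_empty by (intros; lra).
  apply tau_nonneg, level_in_A; auto; lra.
Qed.

(** For [0 < t < 1] the superlevel set of [f] contains [K], so an interval of length 1 already
    contributes [tau K]. *)
Lemma integral_ge_indicator f K : Cc f -> compact K -> ge_indicator X f K -> tau K <= integral f.
Proof.
  intros Hf HK HfK. unfold integral. rewrite (pos_integral_nonpos (fun x => - f x));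
    auto using Cc_opp.
  - destruct (common_bound f f Hf Hf) as [M [HM [HfM _]]].
    destruct (is_RInt_split (level f) 0 1 (M + 1) (pos_integral f)) as [I1 [I2 [H1 [H2 ->]]]];
      [lra | apply is_RInt_pos_integral; auto; [lra | intro x; specialize (HfM x); lra] |].
    assert ((1 - 0) * tau K <= I1).
    { apply (is_RInt_le (fun _ => tau K) (level f) 0 1); auto using is_RInt_const_R; [lra|].
      intros t Ht; apply tau_mono; [left; auto | apply level_in_A; auto; lra |].
      intros x Kx; apply HfK in Kx; lra. }
    assert ((M + 1 - 1) * 0 <= I2); [|lra].
    apply (is_RInt_le (fun _ => 0) (level f) 1 (M + 1)); auto using is_RInt_const_R; [lra|].
    intros t Ht; apply tau_nonneg, level_in_A; auto; lra.
  - intro x; destruct (classic (K x)) as [Kx | Kx]; apply HfK in Kx; lra.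
Qed.

Lemma integral_le_indicator f U : Cc f -> in_O X op U -> le_indicator X f U -> integral f <= tau U.
Proof.
  intros Hf HU HfU. unfold integral.
  pose proof (pos_integral_nonneg _ (Cc_opp f Hf)).
  assert (pos_integral f <= (1 - 0) * tau U); [|lra].
  apply (is_RInt_le (level f) (fun _ => tau U) 0 1); auto using is_RInt_const_R; [lra | |].
  - apply is_RInt_pos_integral; auto; [lra|].
    intro x; destruct (classic (U x)) as [Ux | Ux]; apply HfU in Ux; lra.
  - intros t Ht; apply tau_mono; [apply level_in_A; auto; lra | right; auto |].
    intros x Hx; apply NNPP; intro Ux; apply HfU in Ux; lra.
Qed.

Lemma urysohn_indicator (K U : set) : compact K -> op U -> (forall x, K x -> U x) ->
  exists f, Cc f /\ (forall x, 0 <= f x <= 1) /\ ge_indicator X f K /\ le_indicator X f U.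
Proof.
  intros HK HU HKU; destruct (urysohn K U HK HU HKU) as [f [Hf [H01 [H1 Hs]]]].
  exists f; split; [|split; [|split]]; auto; intro x; split; intro Hx.
  - rewrite H1; auto; lra.
  - apply H01.
  - apply H01.
  - right; apply Cc_eq_zero; auto.
Qed.

(** A Urysohn function between [K] and [U] has its integral between [tau K] and [tau U]; regularity
    of [tau] then closes the gap on either side. *)
Lemma is_tau_of_integral : is_tau_of X op integral tau.
Proof.
  destruct Htau as [_ [_ [_ [HregK HregO]]]]. split.
  - intros K HK; split.
    + intros r [f [Hf [HfK ->]]]; apply integral_ge_indicator; auto.
    + intros b Hb; apply (HregK K HK). intros r [U [HU [HKU ->]]].
      destruct (urysohn_indicator K U) as [f [Hf [_ [H1 H2]]]]; auto; [apply HU|].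
      apply Rle_trans with (integral f); [apply Hb; eauto | apply integral_le_indicator; auto].
  - intros U HU; split.
    + intros r [f [Hf [HfU ->]]]; apply integral_le_indicator; auto.
    + intros b Hb; apply (HregO U HU). intros r [K [HK [HKU ->]]].
      destruct (urysohn_indicator K U) as [f [Hf [_ [H1 H2]]]]; auto; [apply HU|].
      apply Rle_trans with (integral f); [apply integral_ge_indicator; auto | apply Hb; eauto].
Qed.

End FromMeasure.

(** * The topological measure of a quasi-integral *)

Section FromQuasiIntegral.
Variable zeta : (X -> R) -> R.
Hypothesis Hzeta : quasi_integral X op zeta.

Lemma zeta_mono f g : Cc f -> Cc g -> (forall x, f x <= g x) -> zeta f <= zeta g.
Proof. apply (proj1 Hzeta). Qed.

Lemma zeta_quasilinear f phi psi a b :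
  Cc f -> continuity phi -> phi 0 = 0 -> continuity psi -> psi 0 = 0 ->
  zeta (fun x => a * phi (f x) + b * psi (f x)) =
  a * zeta (fun x => phi (f x)) + b * zeta (fun x => psi (f x)).
Proof. intros; apply (proj2 (proj2 Hzeta)); auto. Qed.

Lemma continuity_id : continuity (fun s => s).
Proof. apply (derivable_continuous id), derivable_id. Qed.

Lemma zeta_scal c f : Cc f -> zeta (fun x => c * f x) = c * zeta f.
Proof.
  intro Hf. assert (H := zeta_quasilinear f (fun s => s) (fun s => s) c 0 Hf
    continuity_id eq_refl continuity_id eq_refl).
  change (zeta (fun x => c * f x + 0 * f x) = c * zeta f + 0 * zeta f) in H.
  replace (fun x => c * f x) with (fun x => c * f x + 0 * f x); [rewrite H; lra|].
  apply functional_extensionality; intro; lra.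
Qed.

Lemma zeta_zero : zeta (fun _ => 0) = 0.
Proof.
  assert (H := zeta_scal 0 (fun _ => 0) Cc_zero). simpl in H.
  rewrite Rmult_0_l in H; rewrite H at 1; lra.
Qed.

Lemma zeta_nonneg f : Cc f -> (forall x, 0 <= f x) -> 0 <= zeta f.
Proof. intros Hf H; rewrite <- zeta_zero; apply zeta_mono; auto using Cc_zero. Qed.

Lemma zeta_parts f : Cc f ->
  zeta f = zeta (fun x => Rmax (f x) 0) - zeta (fun x => Rmax (- f x) 0).
Proof.
  intro Hf. assert (H := zeta_quasilinear f (fun s => Rmax s 0) (fun s => Rmax (- s) 0) 1 (-1) Hf).
  simpl in H. replace f with (fun x => 1 * Rmax (f x) 0 + -1 * Rmax (- f x) 0) at 1.
  - rewrite H; [lra | lipschitz_one | apply Rmax_left; lra | lipschitz_one |].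
    rewrite Ropp_0; apply Rmax_left; lra.
  - apply functional_extensionality; intro x; unfold Rmax; repeat destruct Rle_dec; lra.
Qed.

(** [p] and [q] are the positive and negative parts of [p - q], so both belong to the space on which
    quasi-linearity for [p - q] applies. *)
Lemma zeta_add_disjoint p q : Cc p -> Cc q ->
  (forall x, 0 <= p x) -> (forall x, 0 <= q x) -> (forall x, p x = 0 \/ q x = 0) ->
  zeta (fun x => p x + q x) = zeta p + zeta q.
Proof.
  intros Hp Hq Hp0 Hq0 Hpq.
  assert (H := zeta_quasilinear (fun x => p x - q x) (fun s => Rmax s 0) (fun s => Rmax (- s) 0)
                 1 1 (Cc_minus p q Hp Hq)).
  assert (Ep : (fun x => Rmax (p x - q x) 0) = p).
  { apply functional_extensionality; intro x; specialize (Hp0 x); specialize (Hq0 x).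
    unfold Rmax; destruct Rle_dec; destruct (Hpq x); lra. }
  assert (Eq : (fun x => Rmax (- (p x - q x)) 0) = q).
  { apply functional_extensionality; intro x; specialize (Hp0 x); specialize (Hq0 x).
    unfold Rmax; destruct Rle_dec; destruct (Hpq x); lra. }
  simpl in H. rewrite Ep, Eq, !Rmult_1_l in H. rewrite <- H.
  - f_equal; apply functional_extensionality; intro x.
    apply (fun E => equal_f E x) in Ep; apply (fun E => equal_f E x) in Eq; lra.
  - lipschitz_one.
  - apply Rmax_left; lra.
  - lipschitz_one.
  - rewrite Ropp_0; apply Rmax_left; lra.
Qed.

(* Both [g] and [f] are functions of [g + f], namely its truncation at 1 and its excess over 1. *)
Lemma zeta_sub_nested g f : Cc g -> Cc f ->
  (forall x, g x <= 1) -> (forall x, 0 <= f x) -> (forall x, f x <> 0 -> g x = 1) ->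
  zeta (fun x => g x - f x) = zeta g - zeta f.
Proof.
  intros Hg Hf Hg1 Hf0 Hfg.
  assert (H := zeta_quasilinear (fun x => g x + f x) (fun s => Rmin s 1) (fun s => Rmax (s - 1) 0)
                 1 (-1) (Cc_plus g f Hg Hf)).
  assert (Eg : (fun x => Rmin (g x + f x) 1) = g).
  { apply functional_extensionality; intro x; specialize (Hg1 x); specialize (Hf0 x).
    destruct (Req_dec (f x) 0) as [E | E]; [|specialize (Hfg x E)];
      unfold Rmin; destruct Rle_dec; lra. }
  assert (Ef : (fun x => Rmax (g x + f x - 1) 0) = f).
  { apply functional_extensionality; intro x; specialize (Hg1 x); specialize (Hf0 x).
    destruct (Req_dec (f x) 0) as [E | E]; [|specialize (Hfg x E)];
      unfold Rmax; destruct Rle_dec; lra. }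
  simpl in H. rewrite Eg, Ef in H. replace (zeta g - zeta f) with (1 * zeta g + -1 * zeta f) by lra.
  rewrite <- H.
  - f_equal; apply functional_extensionality; intro x.
    apply (fun E => equal_f E x) in Eg; apply (fun E => equal_f E x) in Ef; lra.
  - lipschitz_one.
  - apply Rmin_left; lra.
  - lipschitz_one.
  - apply Rmax_right; lra.
Qed.

(** * Existence of the set function *)

Lemma exists_glb (E : R -> Prop) b : (exists r, E r) -> is_lower_bound E b -> exists m, is_glb E m.
Proof.
  intros [r Hr] Hb.
  destruct (completeness (fun y => E (- y))) as [m [H1 H2]].
  - exists (- b); intros y Hy; apply Hb in Hy; lra.
  - exists (- r); rewrite Ropp_involutive; auto.
  - exists (- m); split.
    + intros y Hy. assert (- y <= m); [|lra]. apply H1; rewrite Ropp_involutive; auto.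
    + intros c Hc. assert (m <= - c); [|lra]. apply H2; intros y Hy; apply Hc in Hy; lra.
Qed.

Lemma le_ge_indicator f g (A B : set) x :
  (forall y, A y -> B y) -> le_indicator X f A -> ge_indicator X g B -> f x <= g x.
Proof.
  intros HAB Hf Hg. specialize (HAB x); specialize (Hf x); specialize (Hg x).
  destruct (classic (A x)); destruct (classic (B x)); intuition lra.
Qed.

(** A compact open set lies in both families, so its infimum and supremum must coincide. Urysohn's
    lemma with [K = U = A] yields a function admissible for both. *)
Lemma exists_tau_of : exists tau, is_tau_of X op zeta tau.
Proof.
  assert (H : forall A, exists m,
    (in_K X op A -> is_glb (fun r => exists f, Cc f /\ ge_indicator X f A /\ r = zeta f) m) /\
    (in_O X op A -> is_lub (fun r => exists f, Cc f /\ le_indicator X f A /\ r = zeta f) m)).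
  - intro A. destruct (classic (in_K X op A)) as [HK | HK].
    + destruct (exists_glb (fun r => exists f, Cc f /\ ge_indicator X f A /\ r = zeta f) 0)
        as [m [H1 H2]].
      * destruct (urysohn_indicator A (fun _ => True)) as [f [Hf [_ [Hge _]]]];
          auto using open_full. eauto.
      * intros r [f [Hf [HfA ->]]]; apply zeta_nonneg; auto.
        intro x; destruct (classic (A x)) as [Ax | Ax]; apply HfA in Ax; lra.
      * exists m; split; [split; auto|]. intros [HO _]. split.
        -- intros r [g [Hg [HgA ->]]]; apply H2; intros r [f [Hf [HfA ->]]].
           apply zeta_mono; auto. intro x; apply (le_ge_indicator g f A A x); auto.
        -- intros b Hb. destruct (urysohn_indicator A A) as [f [Hf [_ [Hge Hle]]]]; auto.
           apply Rle_trans with (zeta f); [apply H1 | apply Hb]; eauto.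
    + destruct (classic (in_O X op A)) as [HO | HO]; [|exists 0; tauto].
      destruct (completeness (fun r => exists f, Cc f /\ le_indicator X f A /\ r = zeta f))
        as [m Hm].
      * destruct (urysohn_indicator (closure A) (fun _ => True)) as [g [Hg [_ [Hge _]]]];
          auto using open_full; [apply HO|].
        exists (zeta g); intros r [f [Hf [HfA ->]]]; apply zeta_mono; auto.
        intro x; apply (le_ge_indicator f g A (closure A) x); auto using subset_closure.
      * exists (zeta (fun _ => 0)), (fun _ => 0); split; [apply Cc_zero|]; split; auto.
        intro x; split; intros; lra.
      * exists m; split; [tauto | auto].
  - apply choice in H; destruct H as [tau Htau]; exists tau.
    split; intros A HA; apply (Htau A); auto.
Qed.

Variable tau : set -> R.
Hypothesis Htau : is_tau_of X op zeta tau.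

(** * Monotonicity and regularity *)

Lemma tau_le_zeta K f : compact K -> Cc f -> ge_indicator X f K -> tau K <= zeta f.
Proof. intros HK Hf HfK; apply (proj1 Htau K HK); eauto. Qed.

Lemma zeta_le_tau U f : in_O X op U -> Cc f -> le_indicator X f U -> zeta f <= tau U.
Proof. intros HU Hf HfU; apply (proj2 Htau U HU); eauto. Qed.

Lemma tau_compact_greatest K b : compact K ->
  (forall f, Cc f -> ge_indicator X f K -> b <= zeta f) -> b <= tau K.
Proof. intros HK H; apply (proj1 Htau K HK); intros r [f [Hf [HfK ->]]]; auto. Qed.

Lemma tau_open_least U b : in_O X op U ->
  (forall f, Cc f -> le_indicator X f U -> zeta f <= b) -> tau U <= b.
Proof. intros HU H; apply (proj2 Htau U HU); intros r [f [Hf [HfU ->]]]; auto. Qed.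

(** Taking the minimum with a Urysohn function localises a nearly optimal [f] in [U]: it stays at
    least 1 on [K], and [zeta] can only decrease. *)
Lemma tau_compact_approx K U eps : compact K -> op U -> (forall x, K x -> U x) -> 0 < eps ->
  exists f, Cc f /\ (forall x, 0 <= f x <= 1) /\ ge_indicator X f K /\ le_indicator X f U /\
    zeta f < tau K + eps.
Proof.
  intros HK HU HKU Heps.
  assert (H : exists f, Cc f /\ ge_indicator X f K /\ zeta f < tau K + eps).
  - apply NNPP; intro H. assert (tau K + eps <= tau K); [|lra].
    apply tau_compact_greatest; auto; intros f Hf HfK.
    apply Rnot_lt_le; intro; apply H; eauto.
  - destruct H as [f [Hf [HfK Hfe]]].
    destruct (urysohn_indicator K U HK HU HKU) as [u [Hu [Hu01 [HuK HuU]]]].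
    assert (Hf0 : forall x, 0 <= f x)
      by (intro x; destruct (classic (K x)) as [Kx | Kx]; apply HfK in Kx; lra).
    exists (fun x => Rmin (f x) (u x)); split; [apply Cc_min; auto|].
    split; [|split; [|split]].
    + intro x; specialize (Hf0 x); specialize (Hu01 x); unfold Rmin; destruct Rle_dec; lra.
    + intro x; specialize (HfK x); specialize (HuK x).
      unfold Rmin; destruct Rle_dec; tauto.
    + intro x; specialize (HuU x). pose proof (Rmin_r (f x) (u x)).
      split; intro Hx; apply HuU in Hx; lra.
    + apply Rle_lt_trans with (2 := Hfe). apply zeta_mono; auto using Cc_min.
      intro; apply Rmin_l.
Qed.

Lemma tau_open_approx U eps : in_O X op U -> 0 < eps ->
  exists f, Cc f /\ (forall x, 0 <= f x <= 1) /\ le_indicator X f U /\ tau U - eps < zeta f.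
Proof.
  intros HU Heps.
  assert (H : exists f, Cc f /\ le_indicator X f U /\ tau U - eps < zeta f).
  - apply NNPP; intro H. assert (tau U <= tau U - eps); [|lra].
    apply tau_open_least; auto; intros f Hf HfU.
    apply Rnot_lt_le; intro; apply H; eauto.
  - destruct H as [f [Hf [HfU Hfe]]].
    exists (fun x => Rmax (f x) 0); split; [apply Cc_max; auto using Cc_zero|].
    split; [|split].
    + intro x; destruct (classic (U x)) as [Ux | Ux]; apply HfU in Ux;
        unfold Rmax; destruct Rle_dec; lra.
    + intro x; specialize (HfU x); unfold Rmax; destruct Rle_dec; intuition lra.
    + apply Rlt_le_trans with (1 := Hfe). apply zeta_mono; auto using Cc_max, Cc_zero.
      intro; apply Rmax_l.
Qed.

Lemma tau_of_nonneg A : in_A X op A -> 0 <= tau A.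
Proof.
  intros [HK | HO].
  - apply tau_compact_greatest; auto; intros f Hf HfA; apply zeta_nonneg; auto.
    intro x; destruct (classic (A x)) as [Ax | Ax]; apply HfA in Ax; lra.
  - rewrite <- zeta_zero; apply zeta_le_tau; auto using Cc_zero.
    intro x; split; intros; lra.
Qed.

Lemma tau_of_mono A A' : in_A X op A -> in_A X op A' -> (forall x, A x -> A' x) -> tau A <= tau A'.
Proof.
  intros [HA | HA] [HA' | HA'] H.
  - apply tau_compact_greatest; auto; intros f Hf HfA; apply tau_le_zeta; auto.
    intro x; specialize (HfA x); specialize (H x); split; intro Hx; [tauto|].
    destruct (classic (A' x)) as [Ax | Ax]; apply HfA in Ax; lra.
  - destruct (urysohn_indicator A A' HA (proj1 HA') H) as [f [Hf [_ [H1 H2]]]].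
    apply Rle_trans with (zeta f); [apply tau_le_zeta | apply zeta_le_tau]; auto.
  - apply tau_open_least; auto; intros f Hf HfA.
    apply tau_compact_greatest; auto; intros g Hg HgA.
    apply zeta_mono; auto; intro x; apply (le_ge_indicator f g A A'); auto.
  - apply tau_open_least; auto; intros f Hf HfA; apply zeta_le_tau; auto.
    intro x; specialize (HfA x); specialize (H x); split; intro Hx; [|tauto].
    destruct (classic (A x)) as [Ax | Ax]; apply HfA in Ax; lra.
Qed.

(** For a nearly optimal [f] the open set [1 - s < f] contains [K], and any function below its
    indicator is at most [f / (1 - s)]. Its measure is thus at most [zeta f / (1 - s)]. *)
Lemma tau_of_compact_regular K : compact K ->
  is_glb (fun r => exists U, in_O X op U /\ (forall x, K x -> U x) /\ r = tau U) (tau K).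
Proof.
  intro HK; split.
  - intros r [U [HU [HKU ->]]]; apply tau_of_mono; auto; [left | right]; auto.
  - intros b Hb; apply le_epsilon; intros eps Heps.
    destruct (tau_compact_approx K (fun _ => True) eps HK open_full (fun _ _ => I) Heps)
      as [f [Hf [Hf01 [HfK [_ Hfe]]]]].
    assert (Hf0 : 0 <= zeta f) by (apply zeta_nonneg; auto; apply Hf01).
    assert (Hs : forall s, 0 < s < 1 -> b * (1 - s) <= zeta f).
    { intros s Hs. apply Rle_div_r; [lra|]. unfold Rdiv; rewrite Rmult_comm.
      rewrite <- zeta_scal by auto.
      apply Rle_trans with (tau (fun x => 1 - s < f x)).
      - apply Hb; exists (fun x => 1 - s < f x); split; [apply in_O_superlevel; auto; lra|].
        split; auto. intros x Kx; apply HfK in Kx; lra.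
      - apply tau_open_least; [apply in_O_superlevel; auto; lra|]. intros g Hg HgU.
        apply zeta_mono; auto using Cc_scal. intro x.
        assert (Hs' : 0 < / (1 - s)) by (apply Rinv_0_lt_compat; lra).
        destruct (classic (1 - s < f x)) as [H | H].
        + apply Rle_trans with (/ (1 - s) * (1 - s)); [|apply Rmult_le_compat_l; lra].
          rewrite Rinv_l by lra; apply HgU; auto.
        + apply HgU in H. specialize (Hf01 x); nra. }
    apply Rnot_lt_le; intro Hlt.
    (* This [s] makes [b * (1 - s)] the midpoint of [b] and [zeta f], which exceeds [zeta f]. *)
    specialize (Hs ((b - zeta f) / (2 * b))).
    assert (Hb0 : 0 < b) by lra.
    assert (E : b * (1 - (b - zeta f) / (2 * b)) = (b + zeta f) / 2) by (field; lra).
    rewrite E in Hs. assert (Hs' : (b + zeta f) / 2 <= zeta f); [|lra].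
    apply Hs; split; [apply Rdiv_lt_0_compat; lra | apply Rlt_div_l; lra].
Qed.

(** A function below the indicator of [U] may be positive right up to the boundary. Lowering it by
    [s] confines its positivity to the compact set [s <= f] inside [U], at a cost of at most
    [N * s]; this is where the Lipschitz property of [zeta] enters. *)
Lemma tau_of_open_regular U : in_O X op U ->
  is_lub (fun r => exists K, in_K X op K /\ (forall x, K x -> U x) /\ r = tau K) (tau U).
Proof.
  intro HU; split.
  - intros r [K [HK [HKU ->]]]; apply tau_of_mono; auto; [left | right]; auto.
  - intros b Hb; apply le_epsilon; intros eps Heps.
    destruct (tau_open_approx U (eps / 2) HU ltac:(lra)) as [f [Hf [Hf01 [HfU Hfe]]]].
    destruct (proj1 (proj2 Hzeta) (support f) (proj2 Hf)) as [N [HN HLip]].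
    set (s := eps / 2 / (N + 1)).
    assert (Hs : 0 < s) by (apply Rdiv_lt_0_compat; lra).
    assert (HNs : N * s <= eps / 2).
    { assert (s * (N + 1) = eps / 2) by (unfold s; field; lra). nra. }
    set (g := fun x => Rmax (f x - s) 0).
    assert (Hg : Cc g).
    { apply (Cc_comp (fun t => Rmax (t - s) 0)); auto; [|apply Rmax_right; lra].
      lipschitz_one. }
    assert (HL : Rabs (zeta f - zeta g) <= N * s).
    { apply HLip; auto.
      - intros x Hx; auto.
      - apply (supported_in_comp (fun t => Rmax (t - s) 0)). apply Rmax_right; lra.
      - intro x; specialize (Hf01 x); unfold g, Rmax, Rabs; destruct Rle_dec;
          destruct Rcase_abs; lra. }
    apply Rabs_le_between in HL.
    assert (Hgt : zeta g <= tau (fun x => s <= f x)).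
    { apply tau_compact_greatest; [apply compact_superlevel; auto|]. intros h Hh HhK.
      apply zeta_mono; auto; intro x; specialize (Hf01 x); specialize (HhK x).
      unfold g, Rmax; destruct Rle_dec; destruct (classic (s <= f x)); intuition lra. }
    assert (Htb : tau (fun x => s <= f x) <= b).
    { apply Hb; exists (fun x => s <= f x); split; [apply compact_superlevel; auto|].
      split; auto. intros x Hx; apply NNPP; intro Ux; apply HfU in Ux; lra. }
    lra.
Qed.

(** * Additivity of the set function *)

Lemma tau_of_add_compact K K' : compact K -> compact K' -> (forall x, ~ (K x /\ K' x)) ->
  tau (fun x => K x \/ K' x) = tau K + tau K'.
Proof.
  intros HK HK' Hdisj.
  (* [V] and the complement of its closure are disjoint open neighbourhoods of [K] and [K'];
     functions confined to them are covered by [zeta_add_disjoint]. *)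
  destruct (interpolate K (fun x => ~ K' x)) as [V [HV [HKV [HcV HVK']]]]; auto.
  { apply compact_closed; auto. }
  { intros x Kx K'x; apply (Hdisj x); auto. }
  set (V' := fun x => ~ closure V x).
  assert (HV' : op V') by apply closed_closure.
  assert (HK'V' : forall x, K' x -> V' x) by (intros x K'x Vx; apply (HVK' x); auto).
  assert (HVV' : forall x, ~ (V x /\ V' x))
    by (intros x [Vx V'x]; apply V'x, subset_closure, Vx).
  assert (Hzero : forall p q, (forall x, 0 <= p x) -> (forall x, 0 <= q x) ->
    le_indicator X p V -> le_indicator X q V' -> forall x, p x = 0 \/ q x = 0).
  { intros p q Hp Hq HpV HqV x. destruct (classic (V x)) as [Vx | Vx].
    - right; apply Rle_antisym; auto. apply HqV; intro; apply (HVV' x); auto.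
    - left; apply Rle_antisym; auto. apply HpV; auto. }
  apply Rle_antisym.
  - apply le_epsilon; intros eps Heps.
    destruct (tau_compact_approx K V (eps / 2) HK HV HKV ltac:(lra))
      as [f [Hf [Hf01 [HfK [HfV Hfe]]]]].
    destruct (tau_compact_approx K' V' (eps / 2) HK' HV' HK'V' ltac:(lra))
      as [g [Hg [Hg01 [HgK [HgV Hge]]]]].
    apply Rle_trans with (zeta (fun x => f x + g x)).
    + apply tau_le_zeta; auto using compact_union, Cc_plus.
      intro x; specialize (Hf01 x); specialize (Hg01 x); specialize (HfK x); specialize (HgK x).
      split; [intros [Kx | Kx]; intuition lra | lra].
    + rewrite zeta_add_disjoint; auto; [lra | apply Hf01 | apply Hg01 |].
      apply Hzero; auto; [apply Hf01 | apply Hg01].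
  - apply tau_compact_greatest; [apply compact_union; auto|]. intros F HF HFK.
    assert (HF0 : forall x, 0 <= F x)
      by (intro x; destruct (classic (K x \/ K' x)) as [Kx | Kx]; apply HFK in Kx; lra).
    destruct (urysohn_indicator K V HK HV HKV) as [u [Hu [Hu01 [HuK HuV]]]].
    destruct (urysohn_indicator K' V' HK' HV' HK'V') as [u' [Hu' [Hu'01 [Hu'K Hu'V]]]].
    (* The parts of [F] over [V] and [V'] are at least 1 on [K] and [K'], have disjoint positivity
       sets, and therefore add up to at most [F]. *)
    set (p := fun x => Rmin (F x) (u x)). set (q := fun x => Rmin (F x) (u' x)).
    assert (Hp : Cc p) by (apply Cc_min; auto).
    assert (Hq : Cc q) by (apply Cc_min; auto).
    assert (Hp0 : forall x, 0 <= p x) by (intro x; apply Rmin_glb; [auto | apply Hu01]).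
    assert (Hq0 : forall x, 0 <= q x) by (intro x; apply Rmin_glb; [auto | apply Hu'01]).
    assert (Hpq : forall x, p x = 0 \/ q x = 0).
    { apply Hzero; auto; intro x; split; intro Hx;
        (apply Rle_trans with (1 := Rmin_r _ _)); [apply HuV | apply HuV | apply Hu'V | apply Hu'V];
        auto. }
    apply Rle_trans with (zeta p + zeta q).
    + apply Rplus_le_compat; apply tau_le_zeta; auto; intro x; split; intro Hx; auto;
        (apply Rmin_glb; [apply HFK; auto |]); [apply HuK | apply Hu'K]; auto.
    + rewrite <- zeta_add_disjoint by auto. apply zeta_mono; auto using Cc_plus.
      intro x; pose proof (Rmin_l (F x) (u x)); pose proof (Rmin_l (F x) (u' x)).
      fold (p x) in H; fold (q x) in H0. destruct (Hpq x) as [E | E]; rewrite E; lra.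
Qed.

Lemma in_O_union U U' : in_O X op U -> in_O X op U' -> in_O X op (fun x => U x \/ U' x).
Proof.
  intros [HU HcU] [HU' HcU']; split; [apply open_union; auto|].
  apply (compact_closure_sub _ (fun x => closure U x \/ closure U' x));
    [apply compact_union; auto|].
  intros x [Ux | Ux]; [left | right]; apply subset_closure, Ux.
Qed.

(** A compact [K] inside the union splits into the disjoint compact sets [K] minus [U'] and [K]
    minus [U], so inner regularity reduces one inequality to the compact case. The other adds nearly
    optimal functions. *)
Lemma tau_of_add_open U U' : in_O X op U -> in_O X op U' -> (forall x, ~ (U x /\ U' x)) ->
  tau (fun x => U x \/ U' x) = tau U + tau U'.
Proof.
  intros HU HU' Hdisj. apply Rle_antisym.
  - apply (tau_of_open_regular _ (in_O_union U U' HU HU')).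
    intros r [K [HK [HKU ->]]].
    set (C := fun x => K x /\ ~ U' x). set (C' := fun x => K x /\ ~ U x).
    assert (HC : forall V, op V -> compact (fun x => K x /\ ~ V x)).
    { intros V HV; apply (compact_subset K); auto; [|tauto].
      unfold closed. replace (fun x => ~ (K x /\ ~ V x)) with (fun x => ~ K x \/ V x)
        by (apply set_ext; intro; tauto).
      apply open_union; auto. apply compact_closed; auto. }
    assert (HC1 : compact C) by (apply HC, HU').
    assert (HC2 : compact C') by (apply HC, HU).
    replace K with (fun x => C x \/ C' x).
    + rewrite tau_of_add_compact; auto.
      * apply Rplus_le_compat; apply tau_of_mono; try (left; assumption); try (right; assumption);
          intros x [Kx Ux]; specialize (HKU x Kx); tauto.
      * intros x [[Kx Hx] [_ Hx']]; specialize (HKU x Kx); tauto.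
    + apply set_ext; intro x; specialize (Hdisj x); unfold C, C'; tauto.
  - apply le_epsilon; intros eps Heps.
    destruct (tau_open_approx U (eps / 2) HU ltac:(lra)) as [f [Hf [Hf01 [HfU Hfe]]]].
    destruct (tau_open_approx U' (eps / 2) HU' ltac:(lra)) as [g [Hg [Hg01 [HgU Hge]]]].
    assert (Hfg : forall x, f x = 0 \/ g x = 0).
    { intro x; destruct (classic (U x)) as [Ux | Ux].
      - right; apply Rle_antisym; [|apply Hg01]. apply HgU; intro; apply (Hdisj x); auto.
      - left; apply Rle_antisym; [|apply Hf01]. apply HfU; auto. }
    assert (zeta f + zeta g <= tau (fun x => U x \/ U' x)); [|lra].
    rewrite <- zeta_add_disjoint; auto; [| apply Hf01 | apply Hg01].
    apply zeta_le_tau; auto using in_O_union, Cc_plus.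
    intro x; specialize (Hf01 x); specialize (Hg01 x); split; intro Hx.
    + destruct (Hfg x) as [E | E]; rewrite E; lra.
    + specialize (HfU x); specialize (HgU x). intuition lra.
Qed.

Lemma in_O_diff W K : in_O X op W -> compact K -> in_O X op (fun x => W x /\ ~ K x).
Proof.
  intros [HW HcW] HK; split; [apply open_diff; auto using compact_closed|].
  apply (compact_closure_sub _ (closure W)); auto. intros x [Wx _]; apply subset_closure, Wx.
Qed.

(** For one inequality, a nearly optimal [f] for [K] is subtracted from a nearly optimal [g] for
    [W]: [g - f] is below the indicator of the difference. For the other, compact subsets of the
    difference are added to [K] inside [W]. *)
Lemma tau_of_diff W K : in_O X op W -> compact K -> (forall x, K x -> W x) ->
  tau W = tau K + tau (fun x => W x /\ ~ K x).
Proof.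
  intros HW HK HKW. assert (HD := in_O_diff W K HW HK). apply Rle_antisym.
  - apply le_epsilon; intros eps Heps.
    destruct (interpolate K W HK (proj1 HW) HKW) as [V [HV [HKV [HcV HVW]]]].
    destruct (tau_open_approx W (eps / 2) HW ltac:(lra)) as [g1 [Hg1 [Hg101 [Hg1W Hg1e]]]].
    destruct (urysohn_indicator (closure V) W HcV (proj1 HW) HVW) as [u [Hu [Hu01 [HuV HuW]]]].
    destruct (tau_compact_approx K V (eps / 2) HK HV HKV ltac:(lra))
      as [f [Hf [Hf01 [HfK [HfV Hfe]]]]].
    (* The maximum with [u] makes [g] equal to 1 on [closure V], hence wherever [f] is nonzero, as
       [zeta_sub_nested] requires. *)
    set (g := fun x => Rmax (g1 x) (u x)).
    assert (Hg : Cc g) by (apply Cc_max; auto).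
    assert (Hgm : zeta g1 <= zeta g)
      by (apply zeta_mono; auto; intro; apply Rmax_l).
    assert (Hg1' : forall x, g x <= 1) by (intro x; apply Rmax_lub; [apply Hg101 | apply Hu01]).
    assert (E := zeta_sub_nested g f Hg Hf Hg1' (fun x => proj1 (Hf01 x))).
    assert (Hle : zeta (fun x => g x - f x) <= tau (fun x => W x /\ ~ K x)).
    { apply zeta_le_tau; auto using Cc_minus. intro x; split; intro Hx.
      - specialize (Hg1' x); specialize (Hf01 x); lra.
      - destruct (classic (K x)) as [Kx | Kx].
        + specialize (Hg1' x); apply HfK in Kx; lra.
        + assert (Wx : ~ W x) by tauto.
          assert (g x <= 0) by (apply Rmax_lub; [apply Hg1W | apply HuW]; auto).
          specialize (Hf01 x); lra. }
    rewrite E in Hle; [lra|].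
    intros x Hx. apply Rle_antisym; auto.
    apply Rle_trans with (u x); [|apply Rmax_r]. apply HuV, subset_closure, NNPP.
    intro Vx; apply HfV in Vx; specialize (Hf01 x); lra.
  - assert (tau (fun x => W x /\ ~ K x) <= tau W - tau K); [|lra].
    apply (tau_of_open_regular _ HD). intros r [K1 [HK1 [H1 ->]]].
    assert (tau (fun x => K x \/ K1 x) <= tau W).
    { apply tau_of_mono; [left; apply compact_union; auto | right; auto |].
      intros x [Kx | Kx]; auto. apply H1, Kx. }
    rewrite tau_of_add_compact in H; auto; [lra|].
    intros x [Kx K1x]; apply H1 in K1x; tauto.
Qed.

(* If the union [C] is compact, take an open [W] around it and split [W] once along [C] and once
   along [K]; subadditivity, which fails in general, is never needed. *)
Lemma tau_of_add_compact_open K U : compact K -> in_O X op U -> (forall x, ~ (K x /\ U x)) ->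
  in_A X op (fun x => K x \/ U x) -> tau (fun x => K x \/ U x) = tau K + tau U.
Proof.
  intros HK HU Hdisj [HC | HW].
  - destruct (interpolate _ (fun _ => True) HC open_full) as [W [HW [HCW [HcW _]]]]; auto.
    assert (HWO : in_O X op W) by (split; auto).
    assert (E1 := tau_of_diff W _ HWO HC HCW).
    assert (E2 := tau_of_diff W K HWO HK (fun x Kx => HCW x (or_introl Kx))).
    replace (fun x => W x /\ ~ K x) with (fun x => U x \/ (W x /\ ~ (K x \/ U x))) in E2.
    + rewrite (tau_of_add_open U (fun x => W x /\ ~ (K x \/ U x))) in E2; auto.
      * lra.
      * apply (in_O_diff W); auto.
      * tauto.
    + apply set_ext; intro x; specialize (Hdisj x); specialize (HCW x).
      destruct (classic (U x)); tauto.
  - rewrite (tau_of_diff _ K HW HK) by tauto. f_equal; f_equal; apply set_ext; intro x.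
    specialize (Hdisj x); tauto.
Qed.

Lemma topological_measure_tau_of : topological_measure X op tau.
Proof.
  split; [|split; [|split; [|split]]].
  - apply tau_of_nonneg.
  - intros A A' [HA | HA] [HA' | HA'] Hdisj HU.
    + apply tau_of_add_compact; auto.
    + apply tau_of_add_compact_open; auto.
    + replace (fun x => A x \/ A' x) with (fun x => A' x \/ A x) in *
        by (apply set_ext; intro; tauto).
      rewrite (Rplus_comm (tau A)). apply tau_of_add_compact_open; auto.
      intros x Hx; apply (Hdisj x); tauto.
    + apply tau_of_add_open; auto.
  - apply tau_of_mono.
  - apply tau_of_compact_regular.
  - apply tau_of_open_regular.
Qed.

(** * Slices of a nonnegative function *)

Definition slice (d : R) (m : nat) (s : R) : R := Rmax 0 (Rmin (s - INR m * d) d).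

Lemma slice_zero d m : 0 < d -> slice d m 0 = 0.
Proof.
  intro Hd; assert (0 <= INR m * d) by (apply Rmult_le_pos; [apply pos_INR | lra]).
  unfold slice, Rmax, Rmin; repeat destruct Rle_dec; lra.
Qed.

Lemma slice_continuity d m : continuity (slice d m).
Proof.
  apply (lipschitz_continuity _ 1); intros s t; generalize (INR m * d); intro c.
  unfold slice, Rmax, Rmin, Rabs; repeat destruct Rle_dec; repeat destruct Rcase_abs; lra.
Qed.

(** The set where [0 <= f] need not be compact, so at [m = 0] the support takes its place; it still
    contains every point where the lowest slice is nonzero. *)
Definition slice_measure (f : X -> R) (d : R) (m : nat) : R :=
  match m with
  | O => tau (support f)
  | S _ => tau (fun x => INR m * d <= f x)
  end.

Lemma slice_measure_nonneg f d m : Cc f -> 0 < d -> 0 <= slice_measure f d m.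
Proof.
  intros Hf Hd; destruct m as [|m]; apply tau_of_nonneg; left; [apply Hf|].
  apply compact_superlevel; auto. apply Rmult_lt_0_compat; auto. apply lt_0_INR; lia.
Qed.

(** Divided by [d], slice [m] is 1 where [(m + 1) d <= f] and 0 where [f < m d], so its value under
    [zeta] is caught between two consecutive measures. *)
Lemma zeta_slice_bounds f d m : Cc f -> 0 < d ->
  d * slice_measure f d (S m) <= zeta (fun x => slice d m (f x)) <= d * slice_measure f d m.
Proof.
  intros Hf Hd.
  assert (Hp : Cc (fun x => slice d m (f x)))
    by (apply Cc_comp; auto using slice_continuity, slice_zero).
  assert (Hd' : 0 < / d) by (apply Rinv_0_lt_compat; auto).
  assert (E : zeta (fun x => slice d m (f x)) = d * zeta (fun x => / d * slice d m (f x)))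
    by (rewrite (zeta_scal (/ d) (fun x => slice d m (f x))) by auto; field; lra).
  assert (Hpd := Cc_scal (/ d) _ Hp). simpl in Hpd.
  assert (H0 : forall s, 0 <= slice d m s <= d)
    by (intro s; unfold slice, Rmax, Rmin; repeat destruct Rle_dec; lra).
  rewrite E; split; apply Rmult_le_compat_l; try lra.
  - apply tau_le_zeta; auto.
    + apply compact_superlevel; auto. apply Rmult_lt_0_compat; auto. apply lt_0_INR; lia.
    + intro x; split; intro Hx.
      * replace (slice d m (f x)) with d; [right; field; lra|].
        rewrite S_INR in Hx; unfold slice, Rmax, Rmin; repeat destruct Rle_dec; lra.
      * specialize (H0 (f x)); nra.
  - assert (H1 : forall s, / d * slice d m s <= 1).
    { intro s; specialize (H0 s). rewrite <- (Rinv_l d) by lra. apply Rmult_le_compat_l; lra. }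
    destruct m as [|m]; simpl slice_measure.
    + apply tau_compact_greatest; [apply Hf|]. intros h Hh HhK; apply zeta_mono; auto.
      intro x; destruct (classic (support f x)) as [Sx | Sx].
      * apply Rle_trans with 1; [auto | apply HhK; auto].
      * rewrite (Cc_eq_zero f x Sx), slice_zero, Rmult_0_r by auto. apply HhK; auto.
    + assert (HSm : 0 < INR (S m) * d) by (apply Rmult_lt_0_compat; auto; apply lt_0_INR; lia).
      apply tau_compact_greatest; [apply compact_superlevel; auto|].
      intros h Hh HhK; apply zeta_mono; auto.
      intro x; destruct (classic (INR (S m) * d <= f x)) as [Sx | Sx].
      * apply Rle_trans with 1; [auto | apply HhK; auto].
      * replace (slice d (S m) (f x)) with 0; [rewrite Rmult_0_r; apply HhK; auto|].
        unfold slice, Rmax, Rmin; repeat destruct Rle_dec; lra.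
Qed.

Lemma zeta_truncation_succ f d m : Cc f -> (forall x, 0 <= f x) -> 0 < d ->
  zeta (fun x => Rmin (f x) (INR (S m) * d)) =
  zeta (fun x => Rmin (f x) (INR m * d)) + zeta (fun x => slice d m (f x)).
Proof.
  intros Hf Hf0 Hd.
  assert (Hmd : 0 <= INR m * d) by (apply Rmult_le_pos; [apply pos_INR | lra]).
  assert (H := zeta_quasilinear f (fun s => Rmin s (INR m * d)) (slice d m) 1 1 Hf).
  simpl in H. rewrite !Rmult_1_l in H. rewrite <- H.
  - f_equal; apply functional_extensionality; intro x; specialize (Hf0 x).
    rewrite S_INR; unfold slice, Rmax, Rmin; repeat destruct Rle_dec; lra.
  - lipschitz_one.
  - apply Rmin_left; auto.
  - apply slice_continuity.
  - apply slice_zero; auto.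
Qed.

End FromQuasiIntegral.

(** * Uniqueness *)

(** On slice [m] the two functionals differ by at most [d] times the drop of [slice_measure] from
    [m] to [m + 1], and the drops telescope. The error thus does not grow with the number of
    slices. *)
Lemma truncation_gap zeta1 zeta2 tau f d m :
  quasi_integral X op zeta1 -> quasi_integral X op zeta2 ->
  is_tau_of X op zeta1 tau -> is_tau_of X op zeta2 tau ->
  Cc f -> (forall x, 0 <= f x) -> 0 < d ->
  zeta1 (fun x => Rmin (f x) (INR m * d)) - zeta2 (fun x => Rmin (f x) (INR m * d))
    <= d * (slice_measure tau f d 0 - slice_measure tau f d m).
Proof.
  intros H1 H2 Ht1 Ht2 Hf Hf0 Hd; induction m as [|m IH].
  - replace (fun x => Rmin (f x) (INR 0 * d)) with (fun _ : X => 0).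
    + rewrite (zeta_zero zeta1), (zeta_zero zeta2) by auto; lra.
    + apply functional_extensionality; intro x; simpl; rewrite Rmult_0_l.
      symmetry; apply Rmin_right; auto.
  - rewrite (zeta_truncation_succ zeta1), (zeta_truncation_succ zeta2) by auto.
    pose proof (zeta_slice_bounds zeta1 H1 tau Ht1 f d m Hf Hd).
    pose proof (zeta_slice_bounds zeta2 H2 tau Ht2 f d m Hf Hd). lra.
Qed.

Lemma zeta_le_nonneg zeta1 zeta2 tau f :
  quasi_integral X op zeta1 -> quasi_integral X op zeta2 ->
  is_tau_of X op zeta1 tau -> is_tau_of X op zeta2 tau ->
  Cc f -> (forall x, 0 <= f x) -> zeta1 f <= zeta2 f.
Proof.
  intros H1 H2 Ht1 Ht2 Hf Hf0.
  destruct (Cc_bounded f Hf) as [M [HM HfM]].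
  set (T := tau (support f)).
  assert (HT : 0 <= T) by (apply (tau_of_nonneg zeta1); auto; left; apply Hf).
  apply le_epsilon; intros eps Heps.
  (* Cutting the height [M + 1], which exceeds [f], into [n + 1] slices makes the total gap [d * T]
     smaller than [eps]. *)
  destruct (nfloor_ex ((M + 1) * T / eps)) as [n [_ Hn]].
  { apply Rdiv_le_0_compat; auto; apply Rmult_le_pos; lra. }
  assert (HSn : 0 < INR (S n)) by (apply lt_0_INR; lia).
  set (d := (M + 1) / INR (S n)).
  assert (Hd : 0 < d) by (apply Rdiv_lt_0_compat; lra).
  assert (E : INR (S n) * d = M + 1) by (unfold d; field; lra).
  assert (G := truncation_gap zeta1 zeta2 tau f d (S n) H1 H2 Ht1 Ht2 Hf Hf0 Hd).
  rewrite E in G.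
  replace (fun x => Rmin (f x) (M + 1)) with f in G.
  - pose proof (slice_measure_nonneg zeta1 H1 tau Ht1 f d (S n) Hf Hd).
    assert (d * T < eps).
    { apply Rlt_div_l in Hn; [|auto]. rewrite <- S_INR in Hn.
      replace (d * T) with ((M + 1) * T / INR (S n)) by (unfold d; field; lra).
      apply Rlt_div_l; [auto | lra]. }
    change (slice_measure tau f d 0) with T in G. nra.
  - apply functional_extensionality; intro x; specialize (HfM x).
    rewrite Rmin_left; auto. pose proof (Rle_abs (f x)); lra.
Qed.

Lemma zeta_unique zeta1 zeta2 tau f :
  quasi_integral X op zeta1 -> quasi_integral X op zeta2 ->
  is_tau_of X op zeta1 tau -> is_tau_of X op zeta2 tau -> Cc f -> zeta1 f = zeta2 f.
Proof.
  intros H1 H2 Ht1 Ht2 Hf.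
  assert (Hnn : forall g, Cc g -> (forall x, 0 <= g x) -> zeta1 g = zeta2 g).
  { intros g Hg Hg0; apply Rle_antisym; eapply zeta_le_nonneg; eauto. }
  rewrite (zeta_parts zeta1 H1 f Hf), (zeta_parts zeta2 H2 f Hf).
  rewrite (Hnn (fun x => Rmax (f x) 0)), (Hnn (fun x => Rmax (- f x) 0));
    auto using Cc_max, Cc_opp, Cc_zero, Rmax_r.
Qed.

End LocallyCompactHausdorff.

Theorem theorem2p1 (X : Type) (op : (X -> Prop) -> Prop)
  (Htop : is_topology X op) (Hhaus : hausdorff X op) (Hlc : locally_compact X op) :
  (* zeta |-> tau_zeta is well defined (the inf/sup exist) and lands in
     the topological measures *)
  (forall zeta, quasi_integral X op zeta ->
     exists tau, is_tau_of X op zeta tau /\ topological_measure X op tau) /\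
  (* injective: quasi-integrals with the same tau agree on C_c(X) *)
  (forall zeta1 zeta2 tau, quasi_integral X op zeta1 -> quasi_integral X op zeta2 ->
     is_tau_of X op zeta1 tau -> is_tau_of X op zeta2 tau ->
     forall f, Cc X op f -> zeta1 f = zeta2 f) /\
  (* surjective onto topological measures *)
  (forall tau, topological_measure X op tau ->
     exists zeta, quasi_integral X op zeta /\ is_tau_of X op zeta tau).
Proof.
  split; [|split].
  - intros zeta Hzeta.
    destruct (exists_tau_of X op Htop Hhaus Hlc zeta Hzeta) as [tau Htau].
    exists tau; split; auto.
    eapply topological_measure_tau_of; eassumption.
  - intros zeta1 zeta2 tau H1 H2 Ht1 Ht2 f Hf.
    eapply zeta_unique; eassumption.
  - intros tau Htau. exists (integral X tau); split.
    + eapply quasi_integral_integral; eassumption.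
    + eapply is_tau_of_integral; eassumption.
Qed.
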